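(* Let $\beta>0$, and let $\mu$ be a deterministic probability measure on $\mathbb{C}$ with at least polynomially decaying tail, i.e. there exists $c>0$ with $$\sup_{R\ge1}R^c\,\mu(\{z\in\mathbb{C}:|z|>R\})<\infty.$$ For each $n\ge2$ let $(Z^{(n,0)}_k)_{1\le k\le n}$ be i.i.d. random variables with distribution $\mu$, let $m(n)$ be an integer with $1\le m(n)\le n-1$, and let $(Z^{(n,j)}_k)_{1\le k\le n}$, $1\le j\le m(n)$, be the zeros of the iterated circular randomized derivatives with parameter $\beta$, with empirical measures $\tilde\mu_{n,j}=\frac1n\sum_{k=1}^n\delta_{Z^{(n,j)}_k}$ (as defined in the context). If $$\frac{m(n)}{n/\log n}\underset{n\to\infty}{\longrightarrow}0,$$ then $(\tilde\mu_{n,m(n)})_{n\ge2}$ converges almost surely to $\mu$.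
   Context: All random variables are defined on one probability space. The Gamma distribution of parameter $\beta/2$ has density $\frac{1}{\Gamma(\beta/2)}t^{\beta/2-1}e^{-t}$ on $(0,\infty)$. Iterated circular randomized derivatives: for each $n\ge2$, let $(\gamma^{(n,j)}_k)_{1\le j\le m(n),\,1\le k\le n}$ be i.i.d. Gamma random variables of parameter $\beta/2$, independent of $(Z^{(n,0)}_k)_{1\le k\le n}$. Inductively for $1\le j\le m(n)$, $(Z^{(n,j)}_k)_{1\le k\le n}$ are the zeros, counted with multiplicity, of the polynomial $$z\mapsto\sum_{k=1}^{n}\gamma^{(n,j)}_k\,(Z^{(n,j-1)}_k+z)\prod_{1\le\ell\le n,\ \ell\ne k}(z-Z^{(n,j-1)}_\ell),$$ which almost surely has degree $n$. The zeros are labelled in some measurable way depending only on $(Z^{(n,j-1)}_\ell)_\ell$ and $(\gamma^{(n,j)}_k)_k$, so that $(\gamma^{(n,j)}_k)_{1\le k\le n}$ is independent of $(Z^{(n,j-1)}_\ell)_{1\le\ell\le n}$. Almost sure convergence of random probability measures means that, almost surely, the sequence converges weakly (tested against bounded continuous functions on $\mathbb{C}$). *)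

(* Defs.v *)
From HB Require Import structures.
From mathcomp Require Import all_boot all_order all_algebra.
From mathcomp Require Import all_classical all_reals all_analysis.
From mathcomp Require Import complex.

Set Implicit Arguments.
Unset Strict Implicit.
Unset Printing Implicit Defensive.

Import Order.TTheory GRing.Theory Num.Theory.
Import numFieldNormedType.Exports.

Local Open Scope classical_set_scope.
Local Open Scope ring_scope.
Local Open Scope complex_scope.

(* R[i] with the topology of its modulus and the Borel sigma-algebra. *)
HB.instance Definition _ (R : realType) :=
  NormedModule.copy R[i] R[i]^o.
HB.instance Definition _ (R : realType) :=
  Measurable.copy R[i] (g_sigma_algebraType (@open R[i])).

Section independence.
Context {d : measure_display} {Omega : measurableType d} {R : realType}.
Variable P : probability Omega R.

Definition mutually_independent {d'} {T : measurableType d'} {I : finType}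
    (X : I -> Omega -> T) : Prop :=
  forall (J : {set I}) (A : I -> set T), (forall i, measurable (A i)) ->
    P (\bigcap_(i in [set` J]) X i @^-1` A i) =
    (\prod_(i in J) P (X i @^-1` A i))%E.

Definition iid {d'} {T : measurableType d'} {I : finType}
    (X : I -> {RV P >-> T}) (law : set T -> \bar R) : Prop :=
  mutually_independent X /\
  forall i A, measurable A -> distribution P (X i) A = law A.

(* the sigma-algebra generated by a family of random variables *)
Definition sigma_family {d'} {T : measurableType d'} {I : Type}
    (X : I -> Omega -> T) : set (set Omega) :=
  <<s \bigcup_i preimage_set_system setT (X i) measurable >>.

Definition independent_families {d1 d2} {T1 : measurableType d1}
    {T2 : measurableType d2} {I1 I2 : Type}
    (X : I1 -> Omega -> T1) (Y : I2 -> Omega -> T2) : Prop :=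
  forall A B, sigma_family X A -> sigma_family Y B ->
    P (A `&` B) = (P A * P B)%E.

End independence.

Arguments iid {d Omega R} P {d' T I} X law.

Section gamma_distribution.
Context {R : realType}.
Local Notation leb := (@lebesgue_measure R).

Definition gamma_fun (a : R) : R :=
  (\int[leb]_(t in `]0%R, +oo[) (t `^ (a - 1) * expR (- t)))%R.

Definition gamma_pdf (a : R) : R -> R :=
  (fun t => (gamma_fun a)^-1 * t `^ (a - 1) * expR (- t)) \_ `]0%R, +oo[.

Definition gamma_law (a : R) (A : set R) : \bar R :=
  (\int[leb]_(t in A) (gamma_pdf a t)%:E)%E.

End gamma_distribution.

Section circular_derivative.
Context {R : realType} {n : nat}.

Definition circular_poly (z : n.-tuple R[i]) (g : n.-tuple R) : {poly R[i]} :=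
  \sum_(k < n) (tnth g k)%:C *:
    (((tnth z k)%:P + 'X) * \prod_(l < n | l != k) ('X - (tnth z l)%:P)).

(* z lists the n zeros of p, with multiplicity; meant for p of degree n. *)
Definition lists_zeros (p : {poly R[i]}) (z : n.-tuple R[i]) : Prop :=
  p = lead_coef p *: \prod_(k < n) ('X - (tnth z k)%:P).

(* For n = 0 this is the zero measure. *)
Definition empirical_measure (z : n.-tuple R[i])
    : {measure set R[i] -> \bar R} :=
  mscale (n%:R^-1)%:nng (msum (fun k => \d_(nth 0 z k)) n).

End circular_derivative.

Section iterated_circular_derivatives.
Context {d : measure_display} {Omega : measurableType d} {R : realType}.
Variables (P : probability Omega R) (n m : nat).

(* gam j k is used for 1 <= j <= m and Z j k for 0 <= j <= m; the other values
   are irrelevant. The zeros of circular_poly are constrained only where it has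
   degree n, which is almost sure. The map F is the measurable labelling. *)
Definition iterated_circular_derivatives (beta : R)
    (gam : nat -> 'I_n -> {RV P >-> R})
    (Z : nat -> 'I_n -> {RV P >-> R[i]}) : Prop :=
  let g := fun p : 'I_m * 'I_n => gam p.1.+1 p.2 in
  let gvec := fun j w => [tuple gam j k w | k < n] in
  let zvec := fun j w => [tuple Z j k w | k < n] in
  [/\ iid P g (gamma_law (beta / 2)),
      independent_families P g (Z 0%N) &
      forall j, (1 <= j <= m)%N ->
        exists2 F : n.-tuple R[i] * n.-tuple R -> n.-tuple R[i],
          measurable_fun setT F &
          {ae P, forall w,
            zvec j w = F (zvec j.-1 w, gvec j w) /\
            (size (circular_poly (zvec j.-1 w) (gvec j w)) = n.+1 ->
             lists_zeros (circular_poly (zvec j.-1 w) (gvec j w)) (zvec j w))}].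

End iterated_circular_derivatives.

Arguments iterated_circular_derivatives {d Omega R} P {n} m beta gam Z.

Definition weak_cvg {R : realType}
    (mu_ : nat -> {measure set R[i] -> \bar R})
    (mu : {measure set R[i] -> \bar R}) : Prop :=
  forall f : R[i] -> R, continuous f -> [bounded f z | z in [set: R[i]]] ->
    (\int[mu_ n]_z (f z)%:E)%E @[n --> \oo] --> (\int[mu]_z (f z)%:E)%E.

Definition polynomial_tail {R : realType} (mu : set R[i] -> \bar R) : Prop :=
  exists2 c : R, 0 < c &
    (ereal_sup [set (r `^ c)%:E * mu [set z | (r < Normc.normc z)%R]
               | r in [set r : R | (1 <= r)%R]] < +oo)%E.

(* Main.v *)
Require Import Defs.
From HB Require Import structures.
From mathcomp Require Import all_boot all_order all_algebra.
From mathcomp Require Import all_classical all_reals all_analysis.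
From mathcomp Require Import measurable_realfun complex.
From mathcomp Require Import ring lra zify.

Set Implicit Arguments.
Unset Strict Implicit.
Unset Printing Implicit Defensive.

Import Order.TTheory GRing.Theory Num.Theory.
Import numFieldNormedType.Exports.

Local Open Scope classical_set_scope.
Local Open Scope ring_scope.
Local Open Scope complex_scope.

Import Normc.
Local Notation Re := complex.Re.
Local Notation Im := complex.Im.

(** Why the theorem is true.

    Let Q_j be the monic polynomial with zeros Z^(n,j)_k. Away from the zeros
    of Q_(j-1), and with Z = Z^(n,j-1), gamma = gamma^(n,j),
      Q_j(x) / Q_(j-1)(x) = (sum_k gamma_k (x + Z_k) / (x - Z_k)) / sum_k gamma_k.
    Suppose that at some points x all these ratios, 1 <= j <= m, have modulus
    between n^-K and n^K. Then log|Q_m(x)| - log|Q_0(x)| is O(m log n) = o(n) at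
    these points, and two empirical measures whose logarithmic potentials agree
    up to o(1) at sufficiently many points are asymptotically equal.

    One step ([circular_step_bounds]). The ratio is large only if x is close to
    some Z_k. It is small only if x is close to - Z_0, or if gamma_0 is close to
    one critical value determined by x, the Z_k and the other weights. As gamma_0
    is independent of these data and its law gives an interval of length e a mass
    O(e^k) for some k > 0, the second event has probability O(e^k)
    ([gamma_measure_itv], [past_anticoncentration]).

    Choice of the points ([failure_set]). The zeros may be anywhere, and mu may
    have atoms, so no fixed x is far from all of them. The points are
    x_k = c + r om_k, where om_k runs through the n-th roots of unity and r
    through a grid of n^6 radii in [rho, rho (1 + 1/n)]. Along one ray a zero is
    close to at most two grid points; counting shows that, outside an event of
    probability O(n^-2), some radius r of the grid is good for all k and all j.

    Reading off the zeros ([circle_potential_close]). The product of |x_k - w|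
    over the n roots of unity is |(w - c)^n - r^n|, and its logarithm is
    n log max(r, |w - c|) up to O(log n) when |w - c| is not too close to r.
    Hence, by Borel-Cantelli, the averages of w |-> log max(rho, |w - c|) over
    the final and over the initial zeros differ by O(m log n / n), which tends to
    0 almost surely ([potentials_close_ae]).

    Conclusion. The difference of two such functions, for the radii rho and
    2 rho, is log 2 times a tent: a continuous function with values in [0, 1],
    equal to 1 on the disc of radius rho and to 0 off the disc of radius 2 rho.
    For countably many tents, the average over the initial sample is almost surely
    at least the integral against mu, up to o(1), by an exponential bound for
    binomial variables ([average_lower_ae]); so the same holds for the final zeros.
    Nonnegative combinations of tents approximate every bounded nonnegative
    continuous f from below in L^1(mu) ([cone_approx]), so that the lower limit of
    the averages of f is at least its integral. Applying this to M + f and M - f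
    gives the weak convergence ([weak_cvg_of_tents]). *)

(** * Modulus, continuity and measurability in the complex plane *)

Section complex_modulus.
Context {R : realType}.
Implicit Types x y : R[i].

Lemma normc_ge0 x : 0 <= normc x.
Proof. by case: x => a b; rewrite /normc sqrtr_ge0. Qed.

Lemma normcN1 x : normc (- x) = normc x.
Proof. exact: (@normcN R x). Qed.

Lemma ler_normcD x y : normc (x + y) <= normc x + normc y.
Proof. exact: (@le_normcD R x y). Qed.

Lemma normcC x y : normc (x - y) = normc (y - x).
Proof. by rewrite -normcN1 opprB. Qed.

Lemma ler_normcB x y : normc x - normc y <= normc (x - y).
Proof. by rewrite lerBlDr (le_trans _ (ler_normcD _ _))// subrK. Qed.

Lemma ler_dist_normc x y : `|normc x - normc y| <= normc (x - y).
Proof.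
by rewrite ler_norml lerNl opprB normcC ler_normcB normcC ler_normcB.
Qed.

Lemma normc_eq0 x : (normc x == 0) = (x == 0).
Proof. by apply/eqP/eqP => [/eq0_normc//|->]; exact: normc0. Qed.

Lemma normc_gt0 x : (0 < normc x) = (x != 0).
Proof. by rewrite lt_neqAle normc_ge0 andbT eq_sym normc_eq0. Qed.

Lemma normcR (a : R) : normc a%:C = `|a|.
Proof. by rewrite /normc /= expr0n/= addr0 sqrtr_sqr. Qed.

Lemma normcX x n : normc (x ^+ n) = normc x ^+ n.
Proof. by elim: n => [|n ih]; rewrite ?expr0 ?normc1// !exprS normcM ih. Qed.

Lemma normc_prod (I : Type) (r : seq I) (Q : pred I) (F : I -> R[i]) :
  normc (\prod_(i <- r | Q i) F i) = \prod_(i <- r | Q i) normc (F i).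
Proof.
elim: r => [|i r ih]; first by rewrite !big_nil normc1.
by rewrite !big_cons; case: ifP => // _; rewrite normcM ih.
Qed.

Lemma ler_normc_sum (I : Type) (r : seq I) (Q : pred I) (F : I -> R[i]) :
  normc (\sum_(i <- r | Q i) F i) <= \sum_(i <- r | Q i) normc (F i).
Proof.
elim/big_ind2 : _ => //; first by rewrite normc0.
by move=> x1 x2 y1 y2 h1 h2; rewrite (le_trans (ler_normcD _ _))// lerD.
Qed.

Lemma ler_Re x : `|Re x| <= normc x.
Proof. by have := @normc_ge_Re R x; rewrite lecR. Qed.

Lemma ler_Im x : `|Im x| <= normc x.
Proof.
case: x => a b; rewrite /normc/= -sqrtr_sqr ler_wsqrtr// lerDr sqr_ge0//.
Qed.

Lemma normc_ReIm x : normc x <= `|Re x| + `|Im x|.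
Proof.
case: x => a b; rewrite [x in normc x]complexE.
rewrite (le_trans (ler_normcD _ _))// normcR normcM normcR.
by rewrite /normc/= expr0n/= expr1n add0r sqrtr1 mul1r.
Qed.

Lemma ReD x y : Re (x + y) = Re x + Re y. Proof. by case: x; case: y. Qed.
Lemma ImD x y : Im (x + y) = Im x + Im y. Proof. by case: x; case: y. Qed.
Lemma ReN x : Re (- x) = - Re x. Proof. by case: x. Qed.
Lemma ImN x : Im (- x) = - Im x. Proof. by case: x. Qed.

Lemma ball_normc (x : R[i]) (e : R) : 0 < e ->
  ball x e%:C = [set y | normc (x - y) < e].
Proof.
move=> e0.
have -> : ball x e%:C = [set y | (normc (x - y))%:C < e%:C] by [].
by apply/seteqP; split => y /=; rewrite ltcR.
Qed.

(** The library topology of the complex plane uses radii that are positive complex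
    numbers; these are real, which gives the usual description by real radii. *)
Lemma nbhs_normcP (x : R[i]) (A : set R[i]) :
  nbhs x A <-> exists2 e : R, 0 < e & forall y, normc (x - y) < e -> A y.
Proof.
split.
  move=> /nbhs_ballP[e/= e0 xA].
  have er : (Re e)%:C = e by apply/RRe_real/gtr0_real.
  have e0' : 0 < Re e by move: e0; rewrite -er ltcR.
  exists (Re e) => // y xy; apply: xA.
  by rewrite -er ball_normc.
move=> [e e0 h]; apply/nbhs_ballP; exists e%:C => /=; first by rewrite ltcR.
by rewrite ball_normc.
Qed.

Lemma continuous_normcP (f : R[i] -> R) : continuous f <->
  forall x (e : R), 0 < e -> exists2 d : R, 0 < d &
    forall y, normc (x - y) < d -> `|f x - f y| < e.
Proof.
split.
  move=> cf x e e0.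
  have /(_ (ball (f x) e)) := cf x.
  move=> /(_ (nbhsx_ballx _ _ e0)) /nbhs_normcP[d d0 h].
  by exists d.
move=> h x A /nbhs_ballP[e /= e0 xA]; apply/nbhs_normcP.
have [d d0 hd] := h x e e0; exists d => // y /hd xy; exact: xA.
Qed.

Lemma lipschitz_continuous_normc (f : R[i] -> R) (k : R) :
  (forall x y, `|f x - f y| <= k * normc (x - y)) -> continuous f.
Proof.
move=> h; apply/continuous_normcP => x e e0.
have k0 : 0 < `|k| + 1 by rewrite ltr_wpDl.
exists (e / (`|k| + 1)); first by rewrite divr_gt0.
move=> y; rewrite ltr_pdivlMr// mulrC; apply: le_lt_trans.
rewrite (le_trans (h _ _))// ler_wpM2r ?normc_ge0//.
by rewrite (le_trans (ler_norm _))// lerDl.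
Qed.

Lemma continuous_measurable_complex (f : R[i] -> R) :
  continuous f -> measurable_fun setT f.
Proof.
move=> cf; apply: (measurability _ (RGenOInfty.measurableE R)).
move=> _ [_ [a ->] <-]; rewrite setTI; apply: sub_sigma_algebra.
by apply: open_comp => //; exact: interval_open.
Qed.

End complex_modulus.

Section complex_measurability.
Context {R : realType} {d : measure_display} {T : measurableType d}.
Implicit Types f g : T -> R[i].

Lemma measurable_norm_lt (f : T -> R) (e : R) :
  measurable_fun setT f -> measurable [set t | `|f t| < e].
Proof.
move=> mf; rewrite (_ : [set t | _] = f @^-1` `](- e), e[).
  rewrite -[X in measurable X]setTI; apply: (mf measurableT).
  exact: measurable_itv.
by apply/seteqP; split => t /=; rewrite in_itv/= ltr_norml.
Qed.

Lemma measurable_Re : measurable_fun setT (@Re R).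
Proof.
apply: continuous_measurable_complex; apply: (@lipschitz_continuous_normc _ _ 1).
by move=> x y; rewrite mul1r -ReN -ReD ler_Re.
Qed.

Lemma measurable_Im : measurable_fun setT (@Im R).
Proof.
apply: continuous_measurable_complex; apply: (@lipschitz_continuous_normc _ _ 1).
by move=> x y; rewrite mul1r -ImN -ImD ler_Im.
Qed.

(** Measurability by coordinates: sums, products and inverses then reduce to the
    corresponding facts for real functions, without comparing the Borel sets of
    the plane with the product sigma-algebra. *)
Definition cmeasurable f :=
  measurable_fun setT (@Re R \o f) /\ measurable_fun setT (@Im R \o f).

Lemma cmeasurable_measurable f : measurable_fun setT f -> cmeasurable f.
Proof.
move=> mf; split; apply: measurableT_comp => //.
exact: measurable_Re. exact: measurable_Im.
Qed.

Lemma cmeasurable_cst (z : R[i]) : cmeasurable (fun=> z).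
Proof. by split; exact: measurable_cst. Qed.

Lemma cmeasurable_real (f : T -> R) :
  measurable_fun setT f -> cmeasurable (fun t => (f t)%:C).
Proof. by move=> mf; split => //; exact: measurable_cst. Qed.

Lemma cmeasurableD f g : cmeasurable f -> cmeasurable g ->
  cmeasurable (fun t => f t + g t).
Proof.
move=> [rf imf] [rg ig]; split.
  rewrite (_ : _ \o _ = (@Re R \o f) \+ (@Re R \o g)).
    exact: measurable_funD.
  by apply/funext => t /=; rewrite ReD.
rewrite (_ : _ \o _ = (@Im R \o f) \+ (@Im R \o g)).
  exact: measurable_funD.
by apply/funext => t /=; rewrite ImD.
Qed.

Lemma cmeasurableN f : cmeasurable f -> cmeasurable (fun t => - f t).
Proof.
move=> [rf imf]; split.
  rewrite (_ : _ \o _ = \- (@Re R \o f)); first exact: measurable_funN.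
  by apply/funext => t /=; rewrite ReN.
rewrite (_ : _ \o _ = \- (@Im R \o f)); first exact: measurable_funN.
by apply/funext => t /=; rewrite ImN.
Qed.

Lemma cmeasurableM f g : cmeasurable f -> cmeasurable g ->
  cmeasurable (fun t => f t * g t).
Proof.
move=> [rf imf] [rg ig]; split.
  rewrite (_ : _ \o _ = ((@Re R \o f) \* (@Re R \o g)) \-
                        ((@Im R \o f) \* (@Im R \o g))).
    by apply: measurable_funB; exact: measurable_funM.
  by apply/funext => t /=; case: (f t); case: (g t).
rewrite (_ : _ \o _ = ((@Re R \o f) \* (@Im R \o g)) \+
                      ((@Im R \o f) \* (@Re R \o g))).
  by apply: measurable_funD; exact: measurable_funM.
by apply/funext => t /=; case: (f t); case: (g t).
Qed.

Lemma measurable_inv_real (f : T -> R) :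
  measurable_fun setT f -> measurable_fun setT (fun t => (f t)^-1).
Proof.
move=> mf; rewrite (_ : (fun t => _) = (fun t => f t * (`|f t| `^ (-1)) ^+ 2)).
  apply: measurable_funM => //; apply: measurable_funX.
  apply: (@measurableT_comp _ _ _ _ _ _ (@powR R ^~ (-1)) _ (fun t => `|f t|)).
    exact: measurable_powR.
  by apply: (@measurableT_comp _ _ _ _ _ _ (@Num.norm R R)) => //; exact: normr_measurable.
apply/funext => t; rewrite powR_inv1//.
have [->|f0] := eqVneq (f t) 0; first by rewrite invr0 mul0r.
rewrite exprVn -normrX ger0_norm ?sqr_ge0// expr2 invfM mulrA divff// mul1r//.
Qed.

Lemma cmeasurableV f : cmeasurable f -> cmeasurable (fun t => (f t)^-1).
Proof.
move=> [rf imf].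
have mi : measurable_fun setT (fun t => ((Re (f t)) ^+ 2 + (Im (f t)) ^+ 2)^-1).
  by apply: measurable_inv_real; apply: measurable_funD; exact: measurable_funX.
split.
  rewrite (_ : _ \o _ = (fun t => Re (f t) * ((Re (f t)) ^+ 2 + (Im (f t)) ^+ 2)^-1)).
    exact: measurable_funM.
  by apply/funext => t /=; case: (f t).
rewrite (_ : _ \o _ = \- (fun t => Im (f t) * ((Re (f t)) ^+ 2 + (Im (f t)) ^+ 2)^-1)).
  by apply: measurable_funN; exact: measurable_funM.
by apply/funext => t /=; case: (f t).
Qed.

Lemma cmeasurable_sum (I : Type) (r : seq I) (Q : pred I) (F : I -> T -> R[i]) :
  (forall i, Q i -> cmeasurable (F i)) ->
  cmeasurable (fun t => \sum_(i <- r | Q i) F i t).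
Proof.
move=> h; elim: r => [|i r ih].
  rewrite (_ : (fun _ => _) = (fun=> 0)); first exact: cmeasurable_cst.
  by apply/funext => t; rewrite big_nil.
case: (boolP (Q i)) => Qi.
  rewrite (_ : (fun _ => _) = (fun t => F i t + \sum_(i <- r | Q i) F i t)).
    by apply: cmeasurableD => //; exact: h.
  by apply/funext => t; rewrite big_cons Qi.
rewrite (_ : (fun _ => _) = (fun t => \sum_(i <- r | Q i) F i t))//.
by apply/funext => t; rewrite big_cons (negbTE Qi).
Qed.

Lemma cmeasurable_normc f : cmeasurable f -> measurable_fun setT (@normc R \o f).
Proof.
move=> [rf imf].
rewrite (_ : _ \o _ = (@Num.sqrt R \o (fun t => ((Re (f t)) ^+ 2 + (Im (f t)) ^+ 2)))).
  apply: measurableT_comp.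
    exact: continuous_measurable_fun (@sqrt_continuous R).
  by apply: measurable_funD; exact: measurable_funX.
by apply/funext => t /=; case: (f t).
Qed.

End complex_measurability.

(** * The Gamma law *)

Section gamma_bounds.
Context {R : realType}.
Local Notation leb := (@lebesgue_measure R).

Lemma powR_subadd (k x y : R) : 0 < k <= 1 -> 0 < x -> 0 < y ->
  (x + y) `^ k <= x `^ k + y `^ k.
Proof.
move=> /andP[k0 k1] x0 y0.
have s0 : 0 < x + y by rewrite addr_gt0.
have frac u v : 0 < u -> 0 < v -> u / (u + v) <= (u / (u + v)) `^ k.
  move=> u0 v0; have uv0 : 0 < u + v by rewrite addr_gt0.
  by apply: ger1_powR => //; rewrite divr_gt0//= ler_pdivrMr// mul1r lerDl ltW.
have pw u v : 0 < u -> 0 < v -> u `^ k = (u / (u + v)) `^ k * (u + v) `^ k.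
  move=> u0 v0; have uv0 : 0 < u + v by rewrite addr_gt0.
  by rewrite -powRM ?divfK ?gt_eqF// ltW// divr_gt0.
rewrite (pw x y)// (pw y x)// [y + x]addrC -mulrDl ler_peMl ?powR_ge0//.
rewrite (@le_trans _ _ (x / (x + y) + y / (x + y)))//; last first.
  rewrite lerD ?frac//.
  by rewrite [x + y]addrC; exact: frac.
by rewrite -mulrDl divff// gt_eqF.
Qed.

(** With [N >= b], [t `^ b <= t ^+ N] for [t >= 1], and
    [expR t = expR (t / N) ^+ N >= (t / N) ^+ N]. *)
Lemma powR_expRN_bounded (b : R) : 0 <= b ->
  exists2 C : R, 0 < C & forall t : R, 0 < t -> t `^ b * expR (- t) <= C.
Proof.
move=> b0; pose N := (Num.truncn b).+1.
have bN : b <= N%:R by rewrite ltW// truncnS_gt.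
have N0 : 0 < N%:R :> R by rewrite ltr0n.
exists (1 + N%:R ^+ N); first by rewrite ltr_pwDl// exprn_ge0// ltW.
move=> t t0; rewrite expRN ler_pdivrMr ?expR_gt0// mulrDl mul1r.
have [t1|t1] := leP t 1.
  rewrite (@le_trans _ _ 1)//.
    have [->|bn0] := eqVneq b 0; first by rewrite powRr0.
    have h1 : (1 : R) `^ b = 1 by rewrite powR1.
    rewrite -[leRHS]h1; apply: ge0_ler_powR => //; rewrite nnegrE ?ltW//.
  rewrite (@le_trans _ _ (expR t))//; first by rewrite ltW// expR_gt1.
  by rewrite lerDl mulr_ge0 ?expR_ge0// exprn_ge0// ltW.
rewrite (@le_trans _ _ (t `^ N%:R))//; first by apply: ler_powR => //; exact: ltW.
rewrite powR_mulrn; last exact: ltW.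
have -> : t = N%:R * (t / N%:R) by rewrite mulrCA divff ?mulr1// gt_eqF.
rewrite expRM_natl exprMn.
rewrite (@le_trans _ _ (N%:R ^+ N * expR (t / N%:R) ^+ N))//.
  apply: ler_wpM2l; first by rewrite exprn_ge0// ltW.
  have tN : 0 < t / N%:R by rewrite divr_gt0// (lt_trans _ t1).
  rewrite lerXn2r// ?nnegrE ?expR_ge0 ?(ltW tN)//.
  by rewrite (le_trans _ (expR_ge1Dx _))// lerDr.
by rewrite lerDr exprn_ge0// expR_ge0.
Qed.

Lemma gamma_fun_ge0 (a : R) : 0 <= gamma_fun a.
Proof.
rewrite /gamma_fun /Rintegral fine_ge0// integral_ge0// => t _.
by rewrite lee_fin mulr_ge0 ?powR_ge0// expR_ge0.
Qed.

Lemma gamma_pdf_ge0 (a t : R) : 0 <= gamma_pdf a t.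
Proof.
rewrite /gamma_pdf patchE; case: ifP => // _.
by rewrite !mulr_ge0// ?invr_ge0 ?gamma_fun_ge0 ?powR_ge0 ?expR_ge0.
Qed.

Lemma gamma_pdf0 (a t : R) : t <= 0 -> gamma_pdf a t = 0.
Proof.
by move=> t0; rewrite /gamma_pdf patchE memNset//= in_itv/= andbT ltNge t0.
Qed.

Lemma gamma_pdfE (a t : R) : 0 < t ->
  gamma_pdf a t = (gamma_fun a)^-1 * t `^ (a - 1) * expR (- t).
Proof.
by move=> t0; rewrite /gamma_pdf patchE mem_set//= in_itv/= t0.
Qed.

Lemma measurable_gamma_pdf (a : R) : measurable_fun setT (gamma_pdf a).
Proof.
apply/(measurable_restrictT _ _).1 => //; apply: measurable_funM.
  by apply: measurable_funM => //; apply: measurable_funTS; exact: measurable_powR.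
by apply: measurableT_comp => //; exact: oppr_measurable.
Qed.

Lemma gamma_law_nonpos (a : R) (A : set R) :
  A `<=` `]-oo, 0] -> gamma_law a A = 0%E.
Proof.
move=> A0; rewrite /gamma_law integral0_eq// => t /A0/=.
by rewrite in_itv/= => t0; rewrite gamma_pdf0.
Qed.

(** With [k = min a 1], the factor [t `^ (a - k) * expR (- t)] of the density is
    bounded, whether the density blows up at 0 or not. *)
Lemma gamma_pdf_le_powR (a : R) : 0 < a -> exists2 k : R, 0 < k <= 1 &
  exists2 C : R, 0 < C & forall t, 0 < t -> gamma_pdf a t <= C * t `^ (k - 1).
Proof.
move=> a0; exists (Num.min a 1); first by rewrite lt_min a0 ltr01/= ge_min lexx orbT.
have [C C0 hC] : exists2 C : R, 0 < C & forall t : R, 0 < t ->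
    t `^ (a - Num.min a 1) * expR (- t) <= C.
  by apply: powR_expRN_bounded; rewrite subr_ge0 ge_min lexx.
exists ((gamma_fun a)^-1 * C + 1).
  by rewrite ltr_wpDl// mulr_ge0 ?invr_ge0 ?gamma_fun_ge0// ltW.
move=> t t0; rewrite gamma_pdfE//.
have -> : a - 1 = (a - Num.min a 1) + (Num.min a 1 - 1) by ring.
rewrite powRD; last by rewrite (gt_eqF t0) implybT.
rewrite mulrDl mul1r -!mulrA; apply: ler_wpDr; first exact: powR_ge0.
rewrite ler_wpM2l ?invr_ge0 ?gamma_fun_ge0//.
by rewrite mulrA mulrAC ler_wpM2r ?powR_ge0// hC.
Qed.

Lemma integral_powR_itv (k x y : R) : 0 < k -> 0 < x -> x < y ->
  (\int[leb]_(t in `[x, y]) (t `^ (k - 1))%:E =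
   (k^-1 * y `^ k)%:E - (k^-1 * x `^ k)%:E)%E.
Proof.
move=> k0 x0 xy.
have itvP t : t \in `]x, y[ -> 0 < t by rewrite in_itv/= => /andP[/(lt_trans x0)].
have cpow (p t : R) : 0 < t -> {for t, continuous (@powR R ^~ p)}.
  move=> t0; apply: differentiable_continuous; apply/derivable1_diffP.
  by apply: derivable_powR; rewrite in_itv/= t0.
apply: (@continuous_FTC2 _ _ (fun t => k^-1 * t `^ k)) => //.
- apply: continuous_in_subspaceT => t; rewrite inE/= in_itv/= => /andP[xt _].
  exact/cpow/(lt_le_trans x0).
- split.
  + move=> t /itvP t0; apply: derivableM => //.
    by apply: derivable_powR; rewrite in_itv/= t0.
  + by apply: cvgMr; apply/cvg_at_right_filter; exact: cpow.
  + by apply: cvgMr; apply/cvg_at_left_filter; apply: cpow; exact: lt_trans xy.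
- move=> t /itvP t0.
  rewrite derive1Ml; last by apply: derivable_powR; rewrite in_itv/= t0.
  by rewrite powR_derive1 ?in_itv/= ?t0// mulrA mulVf ?mul1r// gt_eqF.
Qed.

(** The density is at most [C t `^ (k - 1)], whose integral from [x] to [y]
    is [C / k * (y `^ k - x `^ k)], and [t |-> t `^ k] is subadditive. *)
Lemma gamma_law_itv_pos (a : R) : 0 < a -> exists2 k : R, 0 < k &
  exists2 C : R, 0 < C & forall x y, 0 < x -> x < y ->
    (gamma_law a `[x, y] <= (C * (y - x) `^ k)%:E)%E.
Proof.
move=> /gamma_pdf_le_powR[k k01 [C C0 hC]].
have k0 : 0 < k by case/andP: k01.
exists k => //; exists (C * k^-1); first by rewrite mulr_gt0// invr_gt0.
move=> x y x0 xy.
have pos t : `[x, y]%classic t -> 0 < t.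
  by rewrite /= in_itv/= => /andP[/(lt_le_trans x0)].
have mp : measurable_fun `[x, y] (fun t : R => (t `^ (k - 1))%:E).
  apply/measurable_EFinP; apply: measurable_funTS; exact: measurable_powR.
apply: (@le_trans _ _ (\int[leb]_(t in `[x, y]) (C%:E * (t `^ (k - 1))%:E))%E).
  apply: ge0_le_integral => //.
  - by move=> t _; rewrite lee_fin gamma_pdf_ge0.
  - by apply/measurable_EFinP; apply: measurable_funTS; exact: measurable_gamma_pdf.
  - exact: measurable_funeM.
  - by move=> t /pos t0; rewrite -EFinM lee_fin hC.
rewrite ge0_integralZl_EFin//; last 2 first.
- by move=> t _; rewrite lee_fin powR_ge0.
- exact: ltW.
rewrite integral_powR_itv// -EFinB -EFinM lee_fin -mulrBr mulrA.
apply: ler_wpM2l; first by rewrite mulr_ge0// ?invr_ge0 ltW.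
rewrite lerBlDr -{1}(subrK x y) powR_subadd// subr_gt0//.
Qed.

(** This is the small-ball bound behind the lower bound for the ratio of
    consecutive polynomials. The intervals that meet 0 are exhausted by intervals
    bounded away from 0, where the primitive of the density bound is available. *)
Lemma gamma_measure_itv (a : R) : 0 < a -> exists2 k : R, 0 < k &
  exists2 C : R, 0 < C & forall nu : {measure set R -> \bar R},
    (forall A, measurable A -> nu A = gamma_law a A) -> forall x y, x < y ->
    (nu `[x, y]%classic <= (C * (y - x) `^ k)%:E)%E.
Proof.
move=> a0; have [k k0 [C C0 hC]] := gamma_law_itv_pos a0.
exists k => //; exists C => // nu nuE x y xy.
have [x0|x0] := ltP 0 x; first by rewrite nuE// hC.
have [y0|y0] := leP y 0.
  rewrite nuE// gamma_law_nonpos; last first.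
    by move=> t; rewrite /= !in_itv/= => /andP[_ /le_trans]; apply.
  by rewrite lee_fin mulr_ge0// ?powR_ge0// ltW.
pose F (n : nat) : set R := `[y / n.+2%:R, y]%classic.
have yn n : y / n.+2%:R < y.
  by rewrite ltr_pdivrMr ?ltr0n// ltr_pMr// (ltr_nat R 1).
have nuF n : (nu (F n) <= (C * (y - x) `^ k)%:E)%E.
  have yn0 : 0 < y / n.+2%:R by rewrite divr_gt0.
  rewrite nuE; last exact: measurable_itv.
  apply: (le_trans (hC _ _ yn0 (yn n))).
  rewrite lee_fin ler_wpM2l ?(ltW C0)//; apply: ge0_ler_powR; rewrite ?(ltW k0)//.
  - by rewrite nnegrE subr_ge0 ltW.
  - by rewrite nnegrE subr_ge0 ltW.
  - by rewrite lerB// (le_trans x0)// divr_ge0// ltW.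
have FE : \bigcup_n F n = `]0, y]%classic.
  apply/seteqP; split => t /=.
    move=> [n _]; rewrite /F/= !in_itv/= => /andP[+ ->]; rewrite andbT.
    by apply: lt_le_trans; rewrite divr_gt0.
  rewrite in_itv/= => /andP[t0 ty].
  exists (Num.truncn (y / t)) => //; rewrite /F/= in_itv/= ty andbT.
  rewrite ler_pdivrMr ?ltr0n// mulrC -ler_pdivrMr// ltW//.
  rewrite (lt_le_trans (truncnS_gt _))// ler_nat//.
have -> : nu `[x, y]%classic = nu `]0, y]%classic.
  rewrite (_ : `[x, y]%classic = `[x, 0]%classic `|` `]0, y]%classic).
    rewrite measureU//.
      rewrite [X in (X + _)%E]nuE// gamma_law_nonpos ?add0e//.
      by move=> t; rewrite /= !in_itv/= => /andP[].
    apply/seteqP; split => // t /= []; rewrite !in_itv/=.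
    by move=> /andP[_ t0] /andP[t1 _]; move: t1; rewrite ltNge t0.
  apply/seteqP; split => t /=; rewrite !in_itv/=.
    by move=> /andP[xt ty]; have [t0|t0] := leP t 0; [left|right]; rewrite ?xt.
  move=> [/andP[xt t0]|/andP[t0 ->]]; rewrite ?xt ?andbT.
    by rewrite (le_trans t0)// ltW.
  by rewrite (le_trans x0)// ltW.
have Fcvg : nu (F n) @[n --> \oo] --> nu (\bigcup_n F n).
  apply: nondecreasing_cvg_mu => //.
    by move=> n; exact: measurable_itv.
    by rewrite FE.
  move=> n m nm; apply/subsetPset => t; rewrite /F/= !in_itv/= => /andP[+ ->].
  rewrite andbT; apply: le_trans; rewrite ler_wpM2l ?(ltW y0)//.
  by rewrite lef_pV2 ?posrE ?ltr0n// ler_nat.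
rewrite -FE -(cvg_lim _ Fcvg)//; apply: lime_le; first by apply/cvg_ex; eexists; exact: Fcvg.
exact: nearW.
Qed.

(** The function [t |-> t * gamma_pdf a t] is bounded by a multiple of the density
    of an exponential variable, which has mass 1. *)
Lemma gamma_law_tail (a : R) : 0 < a -> exists2 C : R, 0 < C & forall t, 0 < t ->
    (gamma_law a `]t, +oo[%classic <= (C / t)%:E)%E.
Proof.
move=> a0; have [C C0 hC] := powR_expRN_bounded (ltW a0).
pose D := (gamma_fun a)^-1 * (2 `^ a * C) * 2.
have D0 : 0 <= D.
  by rewrite !mulr_ge0 ?invr_ge0 ?gamma_fun_ge0 ?powR_ge0// ltW.
exists (D + 1); first by rewrite ltr_wpDl.
move=> t t0.
pose e := exponential_pdf (2^-1 : R).
have bound s : t < s -> gamma_pdf a s <= D / t * e s.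
  move=> ts; have s0 := lt_trans t0 ts.
  rewrite gamma_pdfE// /e exponential_pdfE ?(ltW s0)//.
  rewrite -mulrA mulrAC ler_pdivlMr//.
  rewrite (@le_trans _ _ (((gamma_fun a)^-1 * (s `^ (a - 1) * expR (- s))) * s))//.
    apply: ler_wpM2l; last exact: ltW.
    rewrite mulr_ge0 ?invr_ge0 ?gamma_fun_ge0// mulr_ge0 ?powR_ge0//.
  have -> : D * (2^-1 * expR (- 2^-1 * s)) =
      (gamma_fun a)^-1 * ((2 `^ a * C) * expR (- (s / 2))).
    by rewrite /D mulNr [2^-1 * s]mulrC; move: (gamma_fun a)^-1 => u; field.
  rewrite -mulrA; apply: ler_wpM2l; first by rewrite invr_ge0 gamma_fun_ge0.
  have -> : s `^ (a - 1) * expR (- s) * s = s `^ a * expR (- s).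
    by rewrite mulrAC [_ * s]mulrC mulr_powRB1// ltW.
  have -> : s `^ a = 2 `^ a * (s / 2) `^ a.
    by rewrite -powRM ?divr_ge0 ?(ltW s0)// mulrCA divff// mulr1.
  have -> : expR (- s) = expR (- (s / 2)) * expR (- (s / 2)).
    by rewrite -expRD; congr expR; field.
  rewrite mulrA ler_wpM2r ?expR_ge0// -mulrA ler_wpM2l ?powR_ge0//.
  by apply: hC; rewrite divr_gt0.
have me : measurable_fun setT (fun s : R => (e s)%:E).
  by apply/measurable_EFinP; exact: measurable_exponential_pdf.
have e0 s : (0 <= (e s)%:E)%E by rewrite lee_fin exponential_pdf_ge0// invr_ge0.
have Dt0 : 0 <= D / t by rewrite divr_ge0// ltW.
apply: (@le_trans _ _ (\int[leb]_(s in `]t, +oo[) ((D / t)%:E * (e s)%:E))%E).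
  apply: ge0_le_integral => //.
  - by move=> s _; rewrite lee_fin gamma_pdf_ge0.
  - by apply/measurable_EFinP; apply: measurable_funTS; exact: measurable_gamma_pdf.
  - by apply: measurable_funeM; exact: measurable_funTS.
  - by move=> s /=; rewrite in_itv/= andbT => /bound; rewrite -EFinM lee_fin.
rewrite ge0_integralZl_EFin//; last exact: measurable_funTS.
apply: (@le_trans _ _ ((D / t)%:E * 1)%E).
  rewrite lee_wpmul2l ?lee_fin// -(@integral_exponential_pdf R 2^-1) ?invr_gt0//.
  exact: ge0_subset_integral.
by rewrite mule1 lee_fin ler_wpM2r ?invr_ge0 ?(ltW t0)// lerDl.
Qed.

End gamma_bounds.

(** * Independence from the past *)

Section anticoncentration.
Context {R : realType} {d : measure_display} {T : measurableType d}.
Variable P : probability T R.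
Local Open Scope ereal_scope.

(** The line is cut into cells of length [eta]. If [X] lies in a given cell and
    [|g - X| < eta], then [g] lies in an interval of length [3 * eta]; by
    independence the probability of both is at most [Q] times that of the first,
    and the cells are disjoint. Since [g > 0] almost surely, cells indexed by
    naturals suffice. *)
Lemma anticoncentration (g X : T -> R) (eta Q : R) :
  measurable_fun setT g -> measurable_fun setT X ->
  (forall A B, measurable A -> measurable B ->
    P (g @^-1` A `&` X @^-1` B) = P (g @^-1` A) * P (X @^-1` B)) ->
  P (g @^-1` `]-oo, 0%R]) = 0 -> (0 < eta)%R -> (0 <= Q)%R ->
  (forall x, P (g @^-1` `[x, (x + 3 * eta)%R]) <= Q%:E) ->
  P [set w | (`|g w - X w| < eta)%R] <= Q%:E.
Proof.
move=> mg mX indep g0 eta0 Q0 gQ.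
have mgi A : measurable A -> measurable (g @^-1` A).
  by move=> mA; rewrite -[X in measurable X]setTI; exact: mg.
have mXi A : measurable A -> measurable (X @^-1` A).
  by move=> mA; rewrite -[X in measurable X]setTI; exact: mX.
(* The cell [J k] starts at [(k - 1) * eta], so that [X > - eta] meets some cell. *)
pose J (k : nat) : set R := `[((k%:R - 1) * eta)%R, (k%:R * eta)%R[%classic.
pose K (k : nat) : set R := `[((k%:R - 2) * eta)%R, ((k%:R - 2) * eta + 3 * eta)%R]%classic.
pose F k := g @^-1` (K k) `&` X @^-1` (J k).
have mJ k : measurable (J k) by exact: measurable_itv.
have mK k : measurable (K k) by exact: measurable_itv.
have mF k : measurable (F k) by apply: measurableI; [exact: mgi|exact: mXi].
have mD : measurable [set w | (`|g w - X w| < eta)%R]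
  by apply: measurable_norm_lt; exact: measurable_funB.
have sub : [set w | (`|g w - X w| < eta)%R] `<=`
    g @^-1` `]-oo, 0%R] `|` \bigcup_k F k.
  move=> w /= gX; have [gw|gw] := leP (g w) 0%R.
    by left; rewrite /= in_itv.
  right; move: gX; rewrite ltr_norml => /andP[h1 h2].
  have X1 : (0 < X w / eta + 1)%R.
    rewrite -ltrBlDr add0r ltr_pdivlMr// mulN1r; lra.
  exists (Num.truncn (X w / eta + 1)) => //.
  have /andP[t1 t2] := truncn_itv (ltW X1).
  set k := Num.truncn _ in t1 t2 *.
  have t1' : (((k%:R - 1) * eta) <= X w)%R.
    by rewrite -ler_pdivlMr// lerBlDr.
  have t2' : (X w < k%:R * eta)%R.
    by rewrite -ltr_pdivrMr//; move: t2; rewrite -[k.+1]addn1 natrD ltrD2r.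
  by split; rewrite /K /J/= !in_itv/=; apply/andP; split => //; nra.
apply: (@le_trans _ _ (P (g @^-1` `]-oo, 0%R] `|` \bigcup_k F k))).
  apply: le_measure => //; rewrite inE//.
  by apply: measurableU; [exact: mgi|exact: bigcupT_measurable].
apply: (le_trans (measureU2 _ _ _)); [exact: mgi|exact: bigcupT_measurable|].
rewrite [X in X + _](_ : _ = 0); last exact: g0.
rewrite add0e.
apply: (@le_trans _ _ (\sum_(k <oo) P (F k))).
  by apply: measure_sigma_subadditive => //; exact: bigcupT_measurable.
apply: (@le_trans _ _ (\sum_(k <oo) (Q%:E * P (X @^-1` J k)))).
  apply: lee_nneseries => //= k _.
  by rewrite /F indep// lee_wpmul2r//; exact: gQ.
rewrite nneseriesZl//.
have tJ : trivIset setT (fun k => X @^-1` J k).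
  apply/trivIsetP => i j _ _ ij; apply/seteqP; split => // w /= [].
  rewrite /J/= !in_itv/= => /andP[a1 a2] /andP[b1 b2].
  have H (p q : nat) x : ((p%:R - 1) * eta <= x)%R -> (x < q%:R * eta)%R -> (p <= q)%N.
    move=> h1 h2; have : ((p%:R - 1) * eta < q%:R * eta)%R by exact: le_lt_trans h2.
    by rewrite ltr_pM2r// ltrBlDr -(natrD _ q 1%N) ltr_nat addn1 ltnS.
  have ij' := H _ _ _ a1 b2; have ji' := H _ _ _ b1 a2.
  by move: ij; rewrite eqn_leq ij' ji'.
rewrite [X in Q%:E * X](_ : _ = P (\bigcup_k X @^-1` J k)); last first.
  rewrite measure_bigcup//; last by move=> k _; exact: mXi.
  by apply: eq_eseriesl => k; rewrite in_setT.
rewrite -[leRHS]mule1 lee_wpmul2l// ?lee_fin// probability_le1//.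
by apply: bigcup_measurable => k _; exact: mXi.
Qed.

End anticoncentration.

Section independence_from_the_past.
Context {R : realType} {d : measure_display} {T : measurableType d}.
Variable P : probability T R.
Local Open Scope ereal_scope.
Context {I : finType} {J : Type} {d' : measure_display} {V : measurableType d'}.
Variables (g : I -> {RV P >-> R}) (Y : J -> T -> V).
Hypotheses (mY : forall j, measurable_fun setT (Y j))
  (gI : mutually_independent P g) (gY : independent_families P g Y).

Definition all_others (p0 : I) : {set I} := finset.setC (finset.set1 p0).

Lemma in_all_others p0 p : (p \in all_others p0) = (p != p0).
Proof. by rewrite finset.in_setC finset.in_set1. Qed.

(** A pi-system that generates the information carried by the initial data [Y] and
    by all the variables [g p] with [p != p0]. *)
Definition past_rectangle (p0 : I) : set (set T) :=
  [set H | exists E A, [/\ sigma_family Y E, (forall p, measurable (A p : set R)) &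
    H = E `&` \bigcap_(p in [set` all_others p0]) (g p @^-1` A p)]].

Lemma sigma_family_measurable E : sigma_family Y E -> measurable E.
Proof.
move=> /(_ measurable); apply; split; first exact: sigma_algebra_measurable.
by move=> _ [j _ [A mA <-]]; exact: mY.
Qed.

Lemma measurable_rect (D : {set I}) (A : I -> set R) : (forall p, measurable (A p)) ->
  measurable (\bigcap_(p in [set` D]) (g p @^-1` A p)).
Proof.
move=> mA; apply: fin_bigcap_measurable => // p _.
by rewrite -[X in measurable X]setTI; exact: measurable_funP.
Qed.

Lemma sigma_family_rect (D : {set I}) (A : I -> set R) : (forall p, measurable (A p)) ->
  sigma_family g (\bigcap_(p in [set` D]) (g p @^-1` A p)).
Proof.
move=> mA; apply: (@fin_bigcap_measurable _
  (g_sigma_algebraType (\bigcup_i preimage_set_system setT (g i) measurable))) => // p _.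
apply: sub_sigma_algebra; exists p => //; exists (A p) => //.
by rewrite setTI.
Qed.

Lemma past_rectangle_measurable p0 : past_rectangle p0 `<=` measurable.
Proof.
move=> _ [E [A [sE mA ->]]]; apply: measurableI.
  exact: sigma_family_measurable.
exact: (measurable_rect _ mA).
Qed.

Lemma past_rectangle_independent p0 (A : set R) (H : set T) : measurable A ->
  past_rectangle p0 H -> P (g p0 @^-1` A `&` H) = P (g p0 @^-1` A) * P H.
Proof.
move=> mA [E [B [sE mB ->]]].
(* The event on [g p0] and the rectangle form one rectangle over all indices. *)
pose B' p := if p == p0 then A else B p.
have mB' p : measurable (B' p) by rewrite /B'; case: ifP.
have rE : \bigcap_(p in [set` finset.setTfor I]) (g p @^-1` B' p) =
    g p0 @^-1` A `&` \bigcap_(p in [set` all_others p0]) (g p @^-1` B p).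
  apply/seteqP; split => [w h|w [h1 h2] p _ /=].
    split; first by have := h p0; rewrite /= finset.in_setT /B' eqxx; exact.
    move=> p /=; rewrite in_all_others => pp0; have := h p; rewrite /= finset.in_setT /B' (negbTE pp0).
    exact.
  rewrite /B'; case: eqP => [->//|/eqP pp0]; apply: h2 => /=.
  by rewrite in_all_others.
have rI := gI (all_others p0) mB.
have rI' := gI (finset.setTfor I) mB'.
have rP : P (\bigcap_(p in [set` finset.setTfor I]) (g p @^-1` B' p)) =
    P (g p0 @^-1` A) * P (\bigcap_(p in [set` all_others p0]) (g p @^-1` B p)).
  rewrite rI rI' (bigD1 p0)/= ?finset.in_setT// {1}/B' eqxx; congr (_ * _).
  rewrite (eq_bigl (fun i => i \in all_others p0)); last by move=> i; rewrite finset.in_setT in_all_others.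
  by apply: eq_bigr => p; rewrite !inE /B' => /negbTE ->.
have sr := sigma_family_rect (finset.setTfor I) mB'.
have so := sigma_family_rect (all_others p0) mB.
by rewrite [E `&` _]setIC setIA -rE (gY sr sE) (gY so sE) rP muleA.
Qed.

Lemma past_rectangle_setI p0 : setI_closed (past_rectangle p0).
Proof.
move=> _ _ [E [A [sE mA ->]]] [F [B [sF mB ->]]].
exists (E `&` F), (fun p => A p `&` B p); split.
- exact: (@measurableI _ (g_sigma_algebraType
    (\bigcup_i preimage_set_system setT (Y i) measurable))).
- by move=> p; exact: measurableI.
- by rewrite setIACA -bigcapI.
Qed.

Lemma past_rectangleT p0 : past_rectangle p0 setT.
Proof.
exists setT, (fun=> setT); split => //.
  exact: (@measurableT _ (g_sigma_algebraType
    (\bigcup_i preimage_set_system setT (Y i) measurable))).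
by rewrite setTI; apply/seteqP; split.
Qed.

(** Both sides, as functions of [H], are finite measures that agree on the
    pi-system, hence on the sigma-algebra it generates. *)
Lemma independent_of_past p0 (A : set R) (H : set T) : measurable A ->
  <<s past_rectangle p0 >> H -> P (g p0 @^-1` A `&` H) = P (g p0 @^-1` A) * P H.
Proof.
move=> mA sH.
have mgA : measurable (g p0 @^-1` A).
  by rewrite -[X in measurable X]setTI; exact: measurable_funP.
have fA : P (g p0 @^-1` A) \is a fin_num by exact: fin_num_measure.
have f0 : (0 <= fine (P (g p0 @^-1` A)))%R by rewrite fine_ge0.
pose m1 := mrestr P mgA.
pose m2 := mscale (NngNum f0) P.
have m2E E : m2 E = P (g p0 @^-1` A) * P E.
  by rewrite -[LHS]/((fine (P (g p0 @^-1` A)))%:E * P E) fineK.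
suff : m1 H = m2 H by rewrite m2E setIC.
apply: (g_sigma_algebra_measure_unique (past_rectangle p0) _ (fun=> setT)) => //.
- exact: past_rectangle_measurable.
- by move=> _; exact: past_rectangleT.
- by rewrite bigcup_const//; exists 0%N.
- exact: past_rectangle_setI.
- move=> E hE; apply: etrans (esym (m2E E)).
  by rewrite -past_rectangle_independent// setIC.
- move=> _; apply: (@le_lt_trans _ _ (P (g p0 @^-1` A))); last by rewrite ltey_eq fA.
  by rewrite -[X in _ <= P X]setTI.
Qed.

Lemma measurable_past_gamma p0 p : p != p0 ->
  measurable_fun (setT : set (g_sigma_algebraType (past_rectangle p0))) (g p : _ -> R).
Proof.
move=> pp0 _ A mA; rewrite setTI; apply: sub_sigma_algebra.
exists setT, (fun q => if q == p then A else setT); split.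
- exact: (@measurableT _ (g_sigma_algebraType
    (\bigcup_i preimage_set_system setT (Y i) measurable))).
- by move=> q; case: ifP.
- rewrite setTI; apply/seteqP; split => [w gw q _|w /(_ p)] /=.
    by case: eqP => // ->.
  by rewrite in_all_others eqxx => /(_ pp0).
Qed.

Lemma measurable_past_start p0 j :
  measurable_fun (setT : set (g_sigma_algebraType (past_rectangle p0))) (Y j).
Proof.
move=> _ A mA; rewrite setTI; apply: sub_sigma_algebra.
exists (Y j @^-1` A), (fun=> setT); split => //.
  apply: sub_sigma_algebra; exists j => //; exists A => //.
  by rewrite setTI.
rewrite [X in _ = _ `&` X](_ : _ = setT) ?setIT//.
by apply/seteqP; split.
Qed.

Lemma past_measurable (p0 : I) (H : set T) :
  <<s past_rectangle p0 >> H -> measurable H.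
Proof.
move=> /(_ measurable); apply; split; first exact: sigma_algebra_measurable.
exact: past_rectangle_measurable.
Qed.

Lemma past_anticoncentration (p0 : I) (X : T -> R) (eta Q : R) :
  measurable_fun (setT : set (g_sigma_algebraType (past_rectangle p0))) X ->
  P (g p0 @^-1` `]-oo, 0%R]) = 0 -> (0 < eta)%R -> (0 <= Q)%R ->
  (forall x, P (g p0 @^-1` `[x, (x + 3 * eta)%R]) <= Q%:E) ->
  P [set w | (`|g p0 w - X w| < eta)%R] <= Q%:E.
Proof.
move=> mX; apply: anticoncentration.
- exact: measurable_funP.
- move=> _ A mA; rewrite setTI; apply: (@past_measurable p0).
  by have := mX measurableT A mA; rewrite setTI.
- move=> A B mA mB; apply: independent_of_past => //.
  by have := mX measurableT B mB; rewrite setTI.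
Qed.

End independence_from_the_past.

Section past_version.
Context {R : realType} {d : measure_display} {Omega : measurableType d}.
Variable P : probability Omega R.
Variables (n m : nat) (beta : R).
Variables (gam : nat -> 'I_n -> {RV P >-> R}) (Z : nat -> 'I_n -> {RV P >-> R[i]}).
Hypothesis iterZ : iterated_circular_derivatives P m beta gam Z.

Let g (p : 'I_m * 'I_n) := gam p.1.+1 p.2.

(** By induction on [j] through the labelling maps: up to a null set, the zeros
    before step [p0.1 + 1] are functions of the initial zeros and of the weights
    of the earlier steps, none of which is the weight [p0]. *)
Lemma zeros_past_version (p0 : 'I_m * 'I_n) (j : nat) : (j <= p0.1)%N ->
  exists2 Zh : g_sigma_algebraType (past_rectangle g (Z 0%N) p0) -> n.-tuple R[i],
    measurable_fun setT Zh &
    {ae P, forall w, [tuple Z j k w | k < n] = Zh w}.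
Proof.
have [_ _ hF] := iterZ.
elim: j => [_|j ih jp].
  exists (fun w => [tuple Z 0%N k w | k < n]); last exact: aeW.
  apply/measurable_fun_tnthP => k.
  rewrite (_ : _ \o _ = Z 0%N k); first exact: measurable_past_start.
  by apply/funext => w /=; rewrite tnth_mktuple.
have [Zh mZh eZh] := ih (ltnW jp).
have [|F mF aeF] := hF j.+1.
  by rewrite ltn0Sn/= (leq_trans jp)// ltnW.
have jm : (j < m)%N by rewrite (leq_trans jp)// ltnW.
exists (fun w => F (Zh w, [tuple gam j.+1 k w | k < n])).
  apply: (measurableT_comp mF); apply/measurable_fun_pairP; split => //.
  apply/measurable_fun_tnthP => k.
  rewrite (_ : _ \o _ = g (Ordinal jm, k)).
    apply: measurable_past_gamma; apply/eqP => h.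
    by move: jp; rewrite -h /= ltnn.
  by apply/funext => w /=; rewrite tnth_mktuple.
apply: filterS2 eZh aeF => w /= <- [-> _].
by [].
Qed.

End past_version.

(** * One circular derivative at one point *)

Section circular_step.
Context {R : realType} {n : nat}.
Implicit Types (x w : R[i]) (zs : n.-tuple R[i]) (gs : n.-tuple R).

Definition mobius x w : R[i] := (x + w) / (x - w).

(** This makes the ratio of consecutive monic polynomials a weighted mean of the
    [mobius x z_l]. *)
Lemma horner_circular_poly zs gs x : (forall l, x != tnth zs l) ->
  (circular_poly zs gs).[x] =
  (\sum_(k < n) (tnth gs k)%:C * mobius x (tnth zs k)) *
  \prod_(l < n) (x - tnth zs l).
Proof.
move=> xz; rewrite /circular_poly horner_sum mulr_suml; apply: eq_bigr => k _.
rewrite hornerZ hornerM hornerD hornerC hornerX horner_prod.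
rewrite [in RHS](bigD1 k)//= -!mulrA; congr (_ * _).
rewrite mulKf ?subr_eq0// [x + _]addrC; congr (_ * _).
by apply: eq_bigr => l _; rewrite hornerXsubC.
Qed.

Lemma circular_term_monic zs (k : 'I_n) :
  let q := ((tnth zs k)%:P + 'X) * \prod_(l < n | l != k) ('X - (tnth zs l)%:P) in
  size q = n.+1 /\ q`_n = 1.
Proof.
move=> q.
have mq : q \is monic.
  by rewrite monicMl ?monic_prod_XsubC// addrC monicXaddC.
have sq : size q = n.+1.
  have : size (q * ('X - (tnth zs k)%:P)) = n.+2.
    rewrite /q -mulrA [X in _ * X]mulrC -(bigD1 k (P := xpredT) (F := fun l => 'X - (tnth zs l)%:P))//=.
    rewrite size_Mmonic ?monic_prod_XsubC//; last first.
      by rewrite addrC -size_poly_eq0 size_XaddC.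
    by rewrite size_prod_XsubC /= addrC size_XaddC -[index_enum _]enumT size_enum_ord.
  rewrite size_Mmonic ?monicXsubC ?monic_neq0// size_XsubC addn2 /=.
  by move=> [].
by split => //; move/monicP: mq; rewrite /lead_coef sq.
Qed.

(** Each summand of [circular_poly] is a weight times a monic polynomial of degree
    [n]. *)
Lemma circular_poly_lead zs gs : 0 < \sum_(k < n) tnth gs k ->
  size (circular_poly zs gs) = n.+1 /\
  lead_coef (circular_poly zs gs) = (\sum_(k < n) tnth gs k)%:C.
Proof.
move=> S0.
have cn : (circular_poly zs gs)`_n = (\sum_(k < n) tnth gs k)%:C.
  rewrite /circular_poly coef_sum rmorph_sum; apply: eq_bigr => k _.
  by rewrite coefZ (circular_term_monic zs k).2 mulr1.
have le : (size (circular_poly zs gs) <= n.+1)%N.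
  apply: (leq_trans (size_sum _ _ _)); apply/bigmax_leqP => k _.
  by apply: (leq_trans (size_scale_leq _ _)); rewrite (circular_term_monic zs k).1.
have sz : size (circular_poly zs gs) = n.+1.
  apply/eqP; rewrite eqn_leq le ltnNge; apply/negP => /leq_sizeP/(_ _ (leqnn n)).
  rewrite cn => /(congr1 (@complex.Re R))/= h.
  by move: S0; rewrite h ltxx.
by split => //; rewrite /lead_coef sz.
Qed.

Lemma mobius_le x w (eta : R) : 0 < eta -> eta <= normc (x - w) ->
  normc (mobius x w) <= 1 + 2 * normc x / eta.
Proof.
move=> eta0 h; have d0 := lt_le_trans eta0 h.
rewrite /mobius normcM normcV ler_pdivrMr//.
have h1 : normc (x + w) <= normc (x - w) + 2 * normc x.
  have -> : x + w = x + x - (x - w) by ring.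
  rewrite (le_trans (ler_normcD _ _))// normcN1 addrC lerD2l.
  by rewrite (le_trans (ler_normcD _ _))// mulr_natl mulr2n.
rewrite (le_trans h1)// [leRHS]mulrDl mul1r lerD2l mulrAC ler_pdivlMr//.
by rewrite ler_wpM2l// mulr_ge0// normc_ge0.
Qed.

(** The triangle inequality gives [|x - w| <= |x + w| + 2 |x|], and
    [t / (t + 2 |x|)] increases with [t]. *)
Lemma mobius_ge x w (eta : R) : 0 < eta -> x != w -> eta <= normc (x + w) ->
  eta / (eta + 2 * normc x) <= normc (mobius x w).
Proof.
move=> eta0 xw h.
have x0 := normc_ge0 x.
rewrite /mobius normcM normcV ler_pdivlMr ?normc_gt0 ?subr_eq0//.
rewrite mulrAC ler_pdivrMr; last by rewrite ltr_pwDl// mulr_ge0.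
have h1 : normc (x - w) <= normc (x + w) + 2 * normc x.
  have -> : x - w = x + x - (x + w) by ring.
  rewrite (le_trans (ler_normcD _ _))// normcN1 addrC lerD2l.
  by rewrite (le_trans (ler_normcD _ _))// mulr_natl mulr2n.
rewrite (le_trans (ler_wpM2l (ltW eta0) h1))//; nra.
Qed.

(** The weighted sum of the [mobius x z_l] is an affine function of the weight of
    index [k]; this is the value of that weight where its modulus is least. *)
Definition critical_weight x (k : 'I_n) zs gs : R :=
  - Re ((\sum_(l < n | l != k) (tnth gs l)%:C * mobius x (tnth zs l)) /
        mobius x (tnth zs k)).

Lemma normc_weighted_sum_ge x k zs gs : mobius x (tnth zs k) != 0 ->
  normc (mobius x (tnth zs k)) * `|tnth gs k - critical_weight x k zs gs| <=
  normc (\sum_(l < n) (tnth gs l)%:C * mobius x (tnth zs l)).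
Proof.
move=> a0; rewrite (bigD1 k)//=.
set a := mobius x (tnth zs k) in a0 *; set b := \sum_(l < n | l != k) _.
have -> : (tnth gs k)%:C * a + b = a * ((tnth gs k)%:C + b / a).
  by rewrite mulrDr [a * (b / a)]mulrC divfK// mulrC.
rewrite [leRHS]normcM ler_wpM2l ?normc_ge0// /critical_weight -/a -/b opprK.
by rewrite (le_trans _ (ler_Re _))// ReD.
Qed.

(** In the ratio of the two products, the weighted sum of the [mobius x z_l] is at
    most the sum of the weights times their largest modulus, and at least
    [|mobius x z_k|] times the distance of the weight [k] to its critical value. *)
Lemma circular_step_bounds x k zs gs zs' (eta eps S0 : R) :
  0 < eta -> 0 < eps ->
  (forall l, 0 < tnth gs l) -> \sum_(l < n) tnth gs l <= S0 ->
  (forall l, eta <= normc (x - tnth zs l)) ->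
  eta <= normc (x + tnth zs k) ->
  eps <= `|tnth gs k - critical_weight x k zs gs| ->
  (size (circular_poly zs gs) = n.+1 -> lists_zeros (circular_poly zs gs) zs') ->
  eta / (eta + 2 * normc x) * eps / S0 * \prod_(l < n) normc (x - tnth zs l)
    <= \prod_(l < n) normc (x - tnth zs' l) /\
  \prod_(l < n) normc (x - tnth zs' l)
    <= (1 + 2 * normc x / eta) * \prod_(l < n) normc (x - tnth zs l).
Proof.
move=> eta0 eps0 gs0 gS xz xk gk hz.
set S := \sum_(l < n) tnth gs l in gS *.
have Sp : 0 < S.
  by rewrite /S (bigD1 k)//= ltr_pwDl// sumr_ge0// => l _; exact: ltW.
have [sz lc] := circular_poly_lead zs Sp.
have {}hz := hz sz.
have xne l : x != tnth zs l.
  by rewrite -subr_eq0 -normc_gt0 (lt_le_trans eta0).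
have key : normc (\sum_(l < n) (tnth gs l)%:C * mobius x (tnth zs l)) *
    \prod_(l < n) normc (x - tnth zs l) = S * \prod_(l < n) normc (x - tnth zs' l).
  have := congr1 (fun p => normc p.[x]) hz.
  rewrite horner_circular_poly// lc hornerZ horner_prod !normcM !normc_prod normcR.
  rewrite gtr0_norm// => ->; congr (_ * _); apply: eq_bigr => l _.
  by rewrite hornerXsubC.
set Pi := \prod_(l < n) normc (x - tnth zs l) in key *.
set Pi' := \prod_(l < n) normc (x - tnth zs' l) in key *.
have Pi0 : 0 <= Pi by apply: prodr_ge0 => l _; exact: normc_ge0.
have Pi'0 : 0 <= Pi' by apply: prodr_ge0 => l _; exact: normc_ge0.
have x0 := normc_ge0 x.
have u0 : 0 < eta / (eta + 2 * normc x).
  by rewrite divr_gt0// ltr_pwDl// mulr_ge0.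
split.
  have a_ge := mobius_ge eta0 (xne k) xk.
  have a0 : mobius x (tnth zs k) != 0 by rewrite -normc_gt0 (lt_le_trans u0).
  have lo : eta / (eta + 2 * normc x) * eps <=
      normc (\sum_(l < n) (tnth gs l)%:C * mobius x (tnth zs l)).
    rewrite (le_trans _ (normc_weighted_sum_ge gs a0))//.
    by rewrite ler_pM// ltW.
  have S00 : 0 < S0 by exact: lt_le_trans gS.
  rewrite mulrAC ler_pdivrMr// (le_trans (ler_wpM2r Pi0 lo))// key mulrC.
  by rewrite ler_wpM2l.
have up : normc (\sum_(l < n) (tnth gs l)%:C * mobius x (tnth zs l)) <=
    S * (1 + 2 * normc x / eta).
  rewrite (le_trans (ler_normc_sum _ _ _))// mulr_suml ler_sum// => l _.
  rewrite normcM normcR gtr0_norm// ler_wpM2l ?(ltW (gs0 l))//.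
  exact: mobius_le.
rewrite -(ler_pM2l Sp) -key mulrA ler_wpM2r//.
Qed.

End circular_step.

(** * Logarithmic potentials of circles *)

Section circle_potential.
Context {R : realType}.
Implicit Types (c w x : R[i]) (r : R).

Lemma unity_roots (n : nat) : (0 < n)%N -> exists2 om : 'I_n -> R[i],
  forall k, normc (om k) = 1 &
  forall c w r, 0 < r ->
    \prod_(k < n) normc (c + r%:C * om k - w) = normc ((w - c) ^+ n - r%:C ^+ n).
Proof.
move=> n0.
have mp : ('X^n - 1 : {poly R[i]}) \is monic by rewrite monicXnsubC.
have sp : size ('X^n - 1 : {poly R[i]}) = n.+1 by rewrite size_XnsubC.
have [rs] := closed_field_poly_normal ('X^n - 1 : {poly R[i]}).
rewrite (monicP mp) scale1r => hrs.
have srs : size rs = n.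
  by have := sp; rewrite hrs size_prod_XsubC => -[].
have prodE u : \prod_(k < n) (u - nth 0 rs k) = u ^+ n - 1.
  have := congr1 (fun p => p.[u]) hrs.
  rewrite !hornerE horner_prod (big_nth 0) srs big_mkord => ->.
  by apply: eq_bigr => k _; rewrite hornerXsubC.
exists (fun k => nth 0 rs k).
  move=> k.
  have : nth 0 rs k ^+ n - 1 = 0.
    by rewrite -prodE (bigD1 k)//= subrr mul0r.
  move/eqP; rewrite subr_eq0 => /eqP/(congr1 (@normc R)); rewrite normcX normc1.
  move=> /eqP; rewrite pexpr_eq1// ?normc_ge0//; first by move/eqP.
move=> c w r r0.
have rC : r%:C != 0 by rewrite -normc_gt0 normcR normr_gt0 gt_eqF.
have -> : (w - c) ^+ n - r%:C ^+ n = r%:C ^+ n * \prod_(k < n) ((w - c) / r%:C - nth 0 rs k).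
  rewrite prodE mulrBr mulr1; congr (_ - _).
  by rewrite -exprMn mulrCA divff// mulr1.
have -> : r%:C ^+ n = \prod_(k < n) r%:C by rewrite prodr_const card_ord.
rewrite -big_split/= normc_prod; apply: eq_bigr => k _.
rewrite -normcN1; congr normc; rewrite mulrBr mulrCA divff// mulr1; ring.
Qed.

(** If [M] and [s] are the larger and the smaller of [r] and [|v|], the modulus lies
    between [M ^+ n - s ^+ n >= M ^+ n.-1 * (M - s)] and [2 * M ^+ n], and
    [(M - s) / M >= eta / (r + eta)] because [M <= r + (M - s)]. *)
Lemma circle_product_bounds (n : nat) (v : R[i]) r (eta : R) : (0 < n)%N ->
  0 < r -> 0 < eta -> eta <= `|r - normc v| ->
  eta / (r + eta) * Num.max r (normc v) ^+ n <= normc (v ^+ n - r%:C ^+ n)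
    <= 2 * Num.max r (normc v) ^+ n.
Proof.
move=> n0 r0 eta0 sep.
set u := normc v in sep *; set M := Num.max r u.
have u0 : 0 <= u by exact: normc_ge0.
have rM : r <= M by rewrite le_max lexx.
have uM : u <= M by rewrite le_max lexx orbT.
have M0 : 0 < M by exact: lt_le_trans rM.
have nr : normc (r%:C ^+ n) = r ^+ n by rewrite normcX normcR gtr0_norm.
have nv : normc (v ^+ n) = u ^+ n by rewrite normcX.
have lo : `|u ^+ n - r ^+ n| <= normc (v ^+ n - r%:C ^+ n).
  by rewrite -nv -nr ler_dist_normc.
apply/andP; split; last first.
  rewrite (le_trans (ler_normcD _ _))// normcN1 nv nr mulr_natl mulr2n.
  by rewrite lerD// lerXn2r// nnegrE// ltW.
rewrite (le_trans _ lo)//.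
have re0 : 0 < r + eta by rewrite addr_gt0.
case: n n0 nr nv lo => // n _ _ _ _; rewrite !exprS.
have Mn0 : 0 <= M ^+ n by rewrite exprn_ge0// ltW.
have pn (a b : R) : 0 <= a -> a <= b -> a * a ^+ n <= a * b ^+ n.
  move=> a0 ab; apply: ler_wpM2l => //; rewrite lerXn2r// nnegrE//.
  exact: le_trans ab.
rewrite mulrA.
have [ur|ru] := leP u r.
  have ME : M = r by apply/max_idPl.
  rewrite ME; rewrite ger0_norm ?subr_ge0// in sep.
  rewrite distrC (le_trans _ (ler_norm _))//.
  have h := pn _ _ u0 ur.
  rewrite (@le_trans _ _ ((r - u) * r ^+ n))//; last by rewrite mulrBl lerB.
  rewrite ler_wpM2r ?exprn_ge0 ?(ltW r0)//.
  by rewrite mulrAC ler_pdivrMr//; nra.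
have ME : M = u by apply/max_idPr/ltW.
rewrite ME; rewrite ltr0_norm ?subr_lt0// opprB in sep.
rewrite (le_trans _ (ler_norm _))//.
have h := pn _ _ (ltW r0) (ltW ru).
rewrite (@le_trans _ _ ((u - r) * u ^+ n))//; last by rewrite mulrBl lerB.
rewrite ler_wpM2r ?exprn_ge0//.
by rewrite mulrAC ler_pdivrMr//; nra.
Qed.

Definition circle_potential c r w : R := ln (Num.max r (normc (w - c))).

Lemma ln_prod (I : finType) (F : I -> R) : (forall i, 0 < F i) ->
  ln (\prod_i F i) = \sum_i ln (F i).
Proof.
move=> F0.
suff [] : 0 < \prod_i F i /\ ln (\prod_i F i) = \sum_i ln (F i) by [].
elim/big_rec2 : _ => [|i s p _ [p0 <-]]; first by rewrite ltr01 ln1.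
by rewrite mulr_gt0// lnM// posrE.
Qed.

(** Summing the logarithms of [|x_k - z_l|] over the points [x_k] first and over
    the zeros afterwards, or the other way round, gives the same number; by the
    previous bounds it is [n] times the sum of the potentials, up to [n * ln B]. *)
Lemma circle_potential_close (n : nat) (zs zs' : n.-tuple R[i]) (om : 'I_n -> R[i])
    c r (eta D B : R) :
  (forall k, normc (om k) = 1) ->
  (forall c w r, 0 < r ->
    \prod_(k < n) normc (c + r%:C * om k - w) = normc ((w - c) ^+ n - r%:C ^+ n)) ->
  (0 < n)%N -> 0 < r -> 0 < eta -> 2 <= B -> (r + eta) / eta <= B ->
  (forall l, eta <= `|r - normc (tnth zs l - c)|) ->
  (forall l, eta <= `|r - normc (tnth zs' l - c)|) ->
  (forall k, `|ln (\prod_(l < n) normc (c + r%:C * om k - tnth zs' l)) -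
              ln (\prod_(l < n) normc (c + r%:C * om k - tnth zs l))| <= D) ->
  `|\sum_(l < n) circle_potential c r (tnth zs' l) -
    \sum_(l < n) circle_potential c r (tnth zs l)| <= D + 2 * ln B.
Proof.
move=> om1 omE n0 r0 eta0 B2 Beta sep sep' hD.
have B0 : 0 < B by rewrite (lt_le_trans _ B2).
have n0R : 0 < n%:R :> R by rewrite ltr0n.
have pos (z : n.-tuple R[i]) : (forall l, eta <= `|r - normc (tnth z l - c)|) ->
    forall k l, 0 < normc (c + r%:C * om k - tnth z l).
  move=> hz k l; rewrite (lt_le_trans eta0)// (le_trans (hz l))//.
  have -> : c + r%:C * om k - tnth z l = r%:C * om k - (tnth z l - c) by ring.
  rewrite (le_trans _ (ler_dist_normc _ _))//.
  by rewrite normcM om1 mulr1 normcR (gtr0_norm r0).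
have sumE (z : n.-tuple R[i]) : (forall l, eta <= `|r - normc (tnth z l - c)|) ->
    `|\sum_(k < n) ln (\prod_(l < n) normc (c + r%:C * om k - tnth z l)) -
      n%:R * \sum_(l < n) circle_potential c r (tnth z l)| <= n%:R * ln B.
  move=> hz.
  rewrite (eq_bigr (fun k => \sum_(l < n) ln (normc (c + r%:C * om k - tnth z l)))).
    2: by move=> k _; rewrite ln_prod// => l; exact: pos.
  rewrite exchange_big/= mulr_sumr -sumrB (le_trans (ler_norm_sum _ _ _))//.
  have -> : n%:R * ln B = \sum_(l < n) ln B.
    by rewrite sumr_const card_ord mulr_natl.
  apply: ler_sum => l _.
  rewrite -ln_prod; last by move=> k; exact: pos.
  rewrite omE//; have /andP[lo up] := circle_product_bounds n0 r0 eta0 (hz l).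
  rewrite /circle_potential.
  set M := Num.max _ _ in lo up *.
  have M0 : 0 < M by rewrite lt_max r0.
  have re0 : 0 < r + eta by rewrite addr_gt0.
  have e0 : 0 < eta / (r + eta) by rewrite divr_gt0.
  have N0 : 0 < normc ((tnth z l - c) ^+ n - r%:C ^+ n).
    by rewrite (lt_le_trans _ lo)// mulr_gt0// exprn_gt0.
  have lnMn : ln (M ^+ n) = n%:R * ln M by rewrite lnXn// mulr_natl.
  rewrite -lnMn ler_norml; apply/andP; split.
    rewrite lerBrDr addrC lerBlDr -lnM ?posrE ?exprn_gt0//.
    rewrite ler_ln ?posrE ?mulr_gt0 ?exprn_gt0//.
    have lo' : eta * M ^+ n <= normc ((tnth z l - c) ^+ n - r%:C ^+ n) * (r + eta).
      by rewrite -ler_pdivrMr// mulrAC.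
    rewrite -(ler_pM2l eta0) (le_trans lo')// [leRHS]mulrCA ler_pM2l// mulrC.
    by rewrite -ler_pdivrMr.
  rewrite lerBlDr -lnM ?posrE ?exprn_gt0//.
  rewrite ler_ln ?posrE ?mulr_gt0 ?exprn_gt0//.
  by rewrite (le_trans up)// ler_wpM2r// ltW// exprn_gt0.
have h1 := sumE _ sep; have h2 := sumE _ sep'.
have h3 : `|\sum_(k < n) ln (\prod_(l < n) normc (c + r%:C * om k - tnth zs' l)) -
  \sum_(k < n) ln (\prod_(l < n) normc (c + r%:C * om k - tnth zs l))| <= n%:R * D.
  rewrite -sumrB (le_trans (ler_norm_sum _ _ _))//.
  have -> : n%:R * D = \sum_(l < n) D by rewrite sumr_const card_ord mulr_natl.
  exact: ler_sum.
rewrite -(ler_pM2l n0R) -[n%:R in leLHS]gtr0_norm// -normrM mulrBr.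
move: h1 h2 h3.
set a1 := \sum_(k < n) ln _; set a2 := \sum_(k < n) ln _.
set b1 := n%:R * _; set b2 := n%:R * \sum_(l < n) _.
rewrite !ler_norml => /andP[h1 h1'] /andP[h2 h2'] /andP[h3 h3'].
by apply/andP; split; rewrite mulrDr mulrCA; lra.
Qed.

Lemma circle_potential_radius c w (rho r : R) : 0 < rho -> rho <= r ->
  `|circle_potential c r w - circle_potential c rho w| <= r / rho - 1.
Proof.
move=> rho0 rhor; have r0 := lt_le_trans rho0 rhor.
rewrite /circle_potential; set u := normc _.
have u0 : 0 <= u by exact: normc_ge0.
set M := Num.max r u; set M' := Num.max rho u.
have M'0 : 0 < M' by rewrite lt_max rho0.
have MM : M' <= M by rewrite ge_max !le_max rhor lexx orbT.
have M0 : 0 < M by exact: lt_le_trans MM.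
have q1 : 1 <= r / rho by rewrite ler_pdivlMr// mul1r.
have MM' : M <= r / rho * M'.
  rewrite ge_max; apply/andP; split.
    rewrite -{1}(divfK (lt0r_neq0 rho0) r) ler_wpM2l ?(le_trans _ q1)//.
    by rewrite le_max lexx.
  rewrite (@le_trans _ _ M')//; first by rewrite le_max lexx orbT.
  by rewrite ler_peMl// ltW.
rewrite ger0_norm; last by rewrite subr_ge0 ler_ln.
rewrite -ln_div ?posrE//.
have q0 : 0 < M / M' by rewrite divr_gt0.
rewrite (@le_trans _ _ (M / M' - 1))//.
  rewrite -{1}(subrK 1 (M / M')) addrC le_ln1Dx//.
  by rewrite ltrBrDr addrC subrr.
by rewrite lerD2r ler_pdivrMr.
Qed.

End circle_potential.

(** * Random events along a grid of radii *)

Lemma sum_eq_le1 (R : realType) (N s : nat) :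
  \sum_(i < N) (i == s :> nat)%:R <= 1 :> R.
Proof.
have [sN|Ns] := ltnP s N.
  rewrite (bigD1 (Ordinal sN))//= eqxx big1 ?addr0// => i.
  by rewrite -val_eqE/= => /negbTE ->.
rewrite big1// => i _; case: eqP => // is_.
by have := ltn_ord i; rewrite is_ ltnNge Ns.
Qed.

Section small_families.
Context {R : realType} {d : measure_display} {T : measurableType d}.
Variable P : probability T R.
Variable M : nat.
Local Open Scope ereal_scope.

(** [A i] is a bad event for the radius of index [i]. The total probability over
    the [M] radii plays the role of the probability for a random radius, without
    a measure on the radii. *)
Definition small_family (v : R) (A : nat -> set T) : Prop :=
  (forall i, measurable (A i)) /\ \sum_(i < M) P (A i) <= v%:E.

Lemma small_familyU u v A B : small_family u A -> small_family v B ->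
  small_family (u + v) (fun i => A i `|` B i).
Proof.
move=> [mA PA] [mB PB]; split; first by move=> i; exact: measurableU.
rewrite EFinD (le_trans _ (leeD PA PB))// -big_split/=.
by apply: lee_sum => i _; exact: measureU2.
Qed.

Lemma small_family_exists (J : finType) v (A : J -> nat -> set T) :
  (forall k, small_family v (A k)) ->
  small_family (#|J|%:R * v) (fun i => [set w | exists k, A k i w]).
Proof.
move=> sA.
have H (s : seq J) : small_family ((size s)%:R * v)
    (fun i => [set w | exists2 k, k \in s & A k i w]).
  elim: s => [|k s ih].
    rewrite mul0r; rewrite (_ : (fun _ => _) = (fun=> set0)).
      by split => //; rewrite big1.
    by apply/funext => i; apply/seteqP; split => // w [].
  rewrite (_ : (fun _ => _) = (fun i => A k i `|` [set w | exists2 k, k \in s & A k i w])).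
    by rewrite /= -natr1 mulrDl mul1r addrC; exact: small_familyU.
  apply/funext => i; apply/seteqP; split => [w [k']|w [Aw|[k' ks Aw]]].
  - rewrite inE => /orP[/eqP ->|ks Aw]; first by left.
    by right; exists k'.
  - by exists k; rewrite ?mem_head.
  - by exists k'; rewrite // inE ks orbT.
have := H (enum J); rewrite -cardE; congr small_family.
apply/funext => i; apply/seteqP; split => [w [k _]|w [k Aw]]; first by exists k.
by exists k; rewrite ?mem_enum.
Qed.

Lemma small_family_const (q v : R) (A : nat -> set T) : (forall i, measurable (A i)) ->
  (forall i, P (A i) <= q%:E) -> (M%:R * q <= v)%R -> small_family v A.
Proof.
move=> mA PA Mq; split => //.
apply: (@le_trans _ _ (\sum_(i < M) q%:E)); first by apply: lee_sum.
by rewrite sumEFin sumr_const card_ord lee_fin -mulr_natl.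
Qed.

(** For every sample, at most two indices [i] satisfy [|a + i D - x| < D]: after
    scaling, an open interval of length 2 contains at most two integers. *)
Lemma small_family_position (x : T -> R) (a D : R) :
  measurable_fun setT x -> (0 < D)%R ->
  small_family 2 (fun i => [set w | (`|a + i%:R * D - x w| < D)%R]).
Proof.
move=> mx D0.
pose A i := [set w | (`|a + i%:R * D - x w| < D)%R].
have mA i : measurable (A i).
  by apply: measurable_norm_lt; exact: measurable_funB.
split => //.
have -> : \sum_(i < M) P (A i) = \int[P]_w (\sum_(i < M) (\1_(A i) w)%:E).
  rewrite ge0_integral_sum//; last first.
    by move=> i; apply/measurable_EFinP; exact: measurable_indic.
  by apply: eq_bigr => i _; rewrite integral_indic// setIT.
apply: (@le_trans _ _ (\int[P]_w (cst 2%:E w))).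
  apply: ge0_le_integral => //.
  - by move=> w _; apply: sume_ge0 => i _; rewrite lee_fin.
  - by apply: emeasurable_sum => i; apply/measurable_EFinP; exact: measurable_indic.
  - move=> w _ /=; rewrite sumEFin lee_fin.
    set y := ((x w - a) / D)%R.
    pose t := Num.truncn y.
    apply: (@le_trans _ _ (\sum_(i < M) ((i == t :> nat)%:R + (i == t.+1 :> nat)%:R)))%R.
      apply: ler_sum => i _; rewrite indicE.
      case: (boolP (w \in A i)) => [|_]; last by rewrite addr_ge0.
      rewrite inE /A/= => h.
      have h' : (`|i%:R - y| < 1)%R.
        rewrite -(ltr_pM2r D0) mul1r -[X in (_ * X < _)%R](gtr0_norm D0) -normrM mulrBl divfK ?gt_eqF//.
        by have -> : (i%:R * D - (x w - a) = a + i%:R * D - x w)%R by ring.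
      move: h'; rewrite ltr_norml => /andP[h1 h2].
      have [y0|y0] := leP 0%R y.
        have /andP[t1 t2] := truncn_itv y0; rewrite -/t in t1 t2.
        have ti : (t <= i)%N.
          by rewrite -ltnS -(ltr_nat R) -natr1; lra.
        have it : (i <= t.+1)%N.
          by rewrite -ltnS -(ltr_nat R) -[t.+2]addn2 natrD; rewrite -natr1 in t2; lra.
        have [->|nt] := eqVneq (i : nat) t; first by rewrite mulr1n lerDl.
        have -> : (i : nat) = t.+1.
          by apply/eqP; rewrite eqn_leq it ltn_neqAle eq_sym nt.
        by rewrite eqxx lerDr.
      have -> : (i : nat) = 0%N.
        by apply/eqP; rewrite -leqn0 -ltnS -(ltr_nat R); lra.
      have -> : t = 0%N.
        by apply/truncn0Pn; rewrite -ltNge (lt_trans y0).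
      by rewrite eqxx lerDl.
    rewrite big_split/=.
    by have -> : (2 = 1 + 1 :> R)%R by []; rewrite lerD// sum_eq_le1.
rewrite integral_cst// [X in _ * X](_ : _ = 1) ?mule1//.
exact: probability_setT.
Qed.

(** The probability of the intersection is at most each [P (A i)], hence at most
    their average. *)
Lemma small_family_all v A : (0 < M)%N -> small_family v A ->
  measurable [set w | forall i, (i < M)%N -> A i w] /\
  P [set w | forall i, (i < M)%N -> A i w] <= (v / M%:R)%:E.
Proof.
move=> M0 [mA PA].
have mB : measurable [set w | forall i, (i < M)%N -> A i w].
  rewrite (_ : mkset _ = \bigcap_(i in `I_M) A i); last by apply/seteqP; split.
  by apply: bigcap_measurable => //; exists 0%N.
split => //.
set B := mkset _ in mB *.
have fB : P B \is a fin_num by exact: fin_num_measure.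
have : \sum_(i < M) P B <= v%:E.
  apply: le_trans PA; apply: lee_sum => i _; apply: le_measure; rewrite ?inE//.
  by move=> w; exact.
rewrite -(fineK fB) sumEFin sumr_const card_ord !lee_fin => h.
by rewrite ler_pdivlMr ?ltr0n// mulr_natr.
Qed.

End small_families.

Section failure_set.
Context {R : realType} {d : measure_display} {Omega : measurableType d}.
Variable P : probability Omega R.
Variables (n m : nat) (beta : R).
Variables (gam : nat -> 'I_n -> {RV P >-> R}) (Z : nat -> 'I_n -> {RV P >-> R[i]}).
Hypothesis iterZ : iterated_circular_derivatives P m beta gam Z.

Let zvec j w := [tuple Z j k w | k < n].
Let gvec j w := [tuple gam j k w | k < n].

Lemma cmeasurable_zeros j k : cmeasurable (Z j k).
Proof. by apply: cmeasurable_measurable; exact: measurable_funP. Qed.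

Lemma cmeasurable_critical d' (T : measurableType d') (zs : T -> n.-tuple R[i])
    (gs : T -> n.-tuple R) x k :
  (forall l, cmeasurable (fun w => tnth (zs w) l)) ->
  (forall l, l != k -> measurable_fun setT (fun w => tnth (gs w) l)) ->
  measurable_fun setT (fun w => critical_weight x k (zs w) (gs w)).
Proof.
move=> mz mg; rewrite /critical_weight.
have mm l : cmeasurable (fun w => mobius x (tnth (zs w) l)).
  apply: cmeasurableM; first by apply: cmeasurableD => //; exact: cmeasurable_cst.
  apply: cmeasurableV; apply: cmeasurableD; first exact: cmeasurable_cst.
  exact: cmeasurableN.
have : cmeasurable (fun w => - ((\sum_(l < n | l != k) (tnth (gs w) l)%:C *
    mobius x (tnth (zs w) l)) / mobius x (tnth (zs w) k))).
  apply: cmeasurableN; apply: cmeasurableM; last exact: cmeasurableV.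
  apply: cmeasurable_sum => l lk; apply: cmeasurableM => //.
  by apply: cmeasurable_real; exact: mg.
case=> h _; rewrite (_ : (fun w => _) = (@Re R \o (fun w => - ((\sum_(l < n | l != k) (tnth (gs w) l)%:C *
    mobius x (tnth (zs w) l)) / mobius x (tnth (zs w) k)))))//.
by apply/funext => w /=; rewrite ReN.
Qed.

(** The zeros may be replaced by a version that is measurable with respect to the
    past; the critical value is then independent of the weight. *)
Lemma near_critical_bound (jj : 'I_m) (k : 'I_n) x (eps q : R) :
  P (gam jj.+1 k @^-1` `]-oo, 0]) = 0%E -> 0 < eps -> 0 <= q ->
  (forall y, (P (gam jj.+1 k @^-1` `[y, (y + 3 * eps)%R]) <= q%:E)%E) ->
  let A := [set w | `|gam jj.+1 k w - critical_weight x k (zvec jj w) (gvec jj.+1 w)| < eps] in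
  measurable A /\ (P A <= q%:E)%E.
Proof.
move=> gpos eps0 q0 gq A.
have mA : measurable A.
  apply: measurable_norm_lt; apply: measurable_funB; first exact: measurable_funP.
  apply: cmeasurable_critical => [l|l _].
    by under eq_fun do rewrite tnth_mktuple; exact: cmeasurable_zeros.
  by under eq_fun do rewrite tnth_mktuple; exact: measurable_funP.
split => //.
pose p0 : 'I_m * 'I_n := (jj, k).
have [[gI _] gY _] := iterZ.
have [Zh mZh eZh] := zeros_past_version iterZ (p0 := p0) (leqnn jj).
pose Xh w := critical_weight x k (Zh w) (gvec jj.+1 w).
pose g (p : 'I_m * 'I_n) := gam p.1.+1 p.2.
have mXh : measurable_fun (setT : set (g_sigma_algebraType (past_rectangle g (Z 0%N) p0))) Xh.
  apply: cmeasurable_critical => [l|l lk].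
    apply: cmeasurable_measurable.
    exact: (@measurableT_comp _ _ _ _ _ _ (@tnth n R[i] ^~ l) _ Zh (measurable_tnth l) mZh).
  rewrite (_ : (fun w => _) = g (jj, l)); last first.
    by apply/funext => w; rewrite tnth_mktuple.
  by apply: measurable_past_gamma; rewrite /p0 xpair_eqE negb_and lk orbT.
have mY j : measurable_fun setT (Z 0%N j) by exact: measurable_funP.
pose D := [set w | (`|g p0 w - Xh w| < eps)%R].
have PD : (P D <= q%:E)%E by exact: (past_anticoncentration mY gI gY mXh).
have mD : measurable D.
  have mXh' : measurable_fun setT (Xh : Omega -> R).
    move=> _ B mB; rewrite setTI; apply: (past_measurable mY (p0 := p0) (g := g)).
    by have := mXh measurableT B mB; rewrite setTI.
  by apply: measurable_norm_lt; apply: measurable_funB => //; exact: measurable_funP.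
have [N [mN N0 hN]] := eZh.
apply: (@le_trans _ _ (P (D `|` N))).
  apply: le_measure; rewrite ?inE//; first exact: measurableU.
  move=> w Aw; have [Nw|nNw] := pselect (N w); first by right.
  left; have eq : zvec jj w = Zh w by apply: contrapT => h; apply/nNw/hN.
  by move: Aw; rewrite /A /D /Xh /= /g /= eq.
apply: (le_trans (measureU2 _ _ _)) => //.
rewrite [X in (_ + X)%E](_ : _ = 0%E); last exact: N0.
by rewrite adde0.
Qed.

Variables (k0 : 'I_n) (c : R[i]) (rho D eps t tau q K B X : R) (M : nat).
Variable om : 'I_n -> R[i].
Hypothesis om1 : forall k, normc (om k) = 1.
Hypothesis omE : forall c w r, 0 < r ->
    \prod_(k < n) normc (c + r%:C * om k - w) = normc ((w - c) ^+ n - r%:C ^+ n).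
Hypotheses (rho0 : 0 < rho) (D0 : 0 < D) (eps0 : 0 < eps) (t0 : 0 < t) (M0 : (0 < M)%N).
Hypotheses (q0 : 0 <= q) (Mq : M%:R * q <= 1).
Hypothesis gpos : forall (jj : 'I_m) (k : 'I_n),
  P (gam jj.+1 k @^-1` `]-oo, 0]) = 0%E.
Hypothesis gq : forall (jj : 'I_m) (k : 'I_n) y,
  (P (gam jj.+1 k @^-1` `[y, (y + 3 * eps)%R]) <= q%:E)%E.
Hypothesis gtau : forall (jj : 'I_m) (k : 'I_n),
  (P (gam jj.+1 k @^-1` `]t, +oo[) <= tau%:E)%E.
Hypothesis cX : normc c + (rho + M%:R * D) <= X.
Hypotheses (K1 : 1 <= K) (Kup : 1 + 2 * X / D <= K)
  (Klo : K^-1 <= D / (D + 2 * X) * eps / (n%:R * t)).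
Hypotheses (B2 : 2 <= B) (Bup : (rho + M%:R * D + D) / D <= B).

Let r i : R := rho + i%:R * D.
Let x i k : R[i] := c + (r i)%:C * om k.

Let bad_position (j : nat) (u : R[i]) (l : 'I_n) (i : nat) : set Omega :=
  [set w | `|rho + i%:R * D - Re ((Z j l w - c) / u)| < D].

Let bad_antipode (j : nat) (u : R[i]) (i : nat) : set Omega :=
  [set w | `|rho + i%:R * D - Re ((- Z j k0 w - c) / u)| < D].

Let bad_radius (j : nat) (l : 'I_n) (i : nat) : set Omega :=
  [set w | `|rho + i%:R * D - normc (Z j l w - c)| < D].

Let bad_weight (jj : 'I_m) (k : 'I_n) (i : nat) : set Omega :=
  [set w | `|gam jj.+1 k0 w -
     critical_weight (x i k) k0 (zvec jj w) (gvec jj.+1 w)| < eps].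

Let bad (i : nat) : set Omega :=
  [set w | exists p : 'I_m * 'I_n,
     ([set w | exists l, bad_position p.1 (om p.2) l i w] `|`
      bad_antipode p.1 (om p.2) i `|` bad_weight p.1 p.2 i) w] `|`
  ([set w | exists l, bad_radius 0 l i w] `|` [set w | exists l, bad_radius m l i w]).

Let v : R := (m * n)%:R * (n%:R * 2 + 2 + 1) + (n%:R * 2 + n%:R * 2).

(** Positions contribute 2 for each zero and each antipode, and near-critical
    weights 1, for each root of unity and each step; the radii too close to some
    [|z - c|], for an initial or a final zero [z], contribute 2 for each zero. *)
Lemma bad_small : small_family P M v bad.
Proof.
have cZ j l : cmeasurable (fun w => Z j l w - c).
  by apply: cmeasurableD; [exact: cmeasurable_zeros|exact: cmeasurable_cst].
apply: small_familyU; last first.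
  have H j : small_family P M (n%:R * 2) (fun i => [set w | exists l, bad_radius j l i w]).
    rewrite -{1}(card_ord n); apply: small_family_exists => l.
    by apply: small_family_position => //; exact: cmeasurable_normc.
  exact: small_familyU.
pose A (p : 'I_m * 'I_n) i := [set w | exists l, bad_position p.1 (om p.2) l i w] `|`
  bad_antipode p.1 (om p.2) i `|` bad_weight p.1 p.2 i.
suff H p : small_family P M (n%:R * 2 + 2 + 1) (A p).
  by have := small_family_exists H; rewrite card_prod !card_ord.
case: p => jj k; rewrite /A /=.
apply: small_familyU; [apply: small_familyU|].
- rewrite -{1}(card_ord n); apply: small_family_exists => l.
  apply: small_family_position => //.
  have [h _] : cmeasurable (fun w => (Z jj l w - c) / om k); last exact: h.
  by apply: cmeasurableM => //; exact: cmeasurable_cst.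
- apply: small_family_position => //.
  have [h _] : cmeasurable (fun w => (- Z jj k0 w - c) / om k); last exact: h.
  apply: cmeasurableM; last exact: cmeasurable_cst.
  apply: cmeasurableD; last exact: cmeasurable_cst.
  by apply: cmeasurableN; exact: cmeasurable_zeros.
- have H i := near_critical_bound (x i k) (gpos jj k0) eps0 q0 (gq jj k0).
  apply: (small_family_const (q := q)) => // i.
    by have [] := H i.
  by have [] := H i.
Qed.

(** Multiplication by [u^-1] preserves the modulus, which dominates the real part;
    this reduces distances in the plane to distances along one ray. *)
Lemma normc_rotate (u w : R[i]) (a : R) : normc u = 1 ->
  `|a - Re ((w - c) / u)| <= normc (c + a%:C * u - w).
Proof.
move=> u1; have u0 : u != 0 by rewrite -normc_gt0 u1.
have -> : c + a%:C * u - w = u * (a%:C - (w - c) / u).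
  by rewrite mulrBr [u * (_ / u)]mulrC divfK// [u * _]mulrC; ring.
rewrite normcM u1 mul1r (le_trans _ (ler_Re _))// ReD ReN//.
Qed.

(** At the points of a good radius each step changes the logarithm of the product by
    at most [ln K], and keeps the product positive, so that the next step can be
    compared with it. *)
Lemma chain_bound w i : (i < M)%N -> ~ bad i w ->
  (forall (jj : 'I_m) k, 0 < gam jj.+1 k w) ->
  (forall (jj : 'I_m) k, gam jj.+1 k w <= t) ->
  (forall jj : 'I_m,
    size (circular_poly (zvec jj w) (gvec jj.+1 w)) = n.+1 ->
    lists_zeros (circular_poly (zvec jj w) (gvec jj.+1 w)) (zvec jj.+1 w)) ->
  forall k j, (j <= m)%N ->
  0 < \prod_(l < n) normc (x i k - tnth (zvec j w) l) /\
  `|ln (\prod_(l < n) normc (x i k - tnth (zvec j w) l)) -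
    ln (\prod_(l < n) normc (x i k - tnth (zvec 0 w) l))| <= j%:R * ln K.
Proof.
move=> iM nbad g0 gt hz k.
have [nbad1 nbad2] : (forall p : 'I_m * 'I_n, ~ ([set w | exists l, bad_position p.1 (om p.2) l i w] `|`
      bad_antipode p.1 (om p.2) i `|` bad_weight p.1 p.2 i) w) /\
    (forall l, ~ bad_radius 0 l i w).
  split; first by move=> p h; apply: nbad; left; exists p.
  by move=> l h; apply: nbad; right; left; exists l.
have ri0 : 0 < r i by rewrite /r ltr_pwDl// mulr_ge0// ltW.
have K0 : 0 < K by exact: lt_le_trans K1.
have n0 : 0 < n%:R :> R by rewrite ltr0n (leq_trans _ (ltn_ord k0)).
have xX : normc (x i k) <= X.
  rewrite (le_trans _ cX)// (le_trans (ler_normcD _ _))// lerD2l.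
  rewrite normcM om1 mulr1 normcR gtr0_norm// lerD2l ler_wpM2r ?(ltW D0)//.
  by rewrite ler_nat ltnW.
have x0 := normc_ge0 (x i k).
elim=> [_|j ih jm].
  split; last by rewrite subrr normr0 mul0r.
  apply: prodr_gt0 => l _; rewrite tnth_mktuple.
  rewrite (lt_le_trans D0)//.
  have := nbad2 l; rewrite /bad_radius/= => /negP; rewrite -leNgt => h.
  rewrite (le_trans h)//.
  have -> : x i k - Z 0 l w = (r i)%:C * om k - (Z 0 l w - c) by rewrite /x; ring.
  rewrite (le_trans _ (ler_dist_normc _ _))//.
  by rewrite normcM om1 mulr1 normcR (gtr0_norm ri0).
have [P0 lnP] := ih (ltnW jm).
pose jj := Ordinal jm.
have nb := nbad1 (jj, k).
have step := @circular_step_bounds R n (x i k) k0 (zvec j w) (gvec j.+1 w) (zvec j.+1 w)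
  D eps (n%:R * t) D0 eps0.
have [] := step.
- by move=> l; rewrite tnth_mktuple; exact: (g0 jj).
- rewrite (@le_trans _ _ (\sum_(l < n) t))//.
    by apply: ler_sum => l _; rewrite tnth_mktuple; exact: (gt jj).
  by rewrite sumr_const card_ord mulr_natl.
- move=> l; rewrite tnth_mktuple.
  rewrite (le_trans _ (normc_rotate (Z j l w) (r i) (om1 k)))//.
  rewrite leNgt; apply/negP => h; apply: nb; left; left; exists l.
  exact: h.
- rewrite tnth_mktuple -[Z j k0 w]opprK.
  rewrite (le_trans _ (normc_rotate (- Z j k0 w) (r i) (om1 k)))//.
  rewrite leNgt; apply/negP => h; apply: nb; left; right.
  exact: h.
- rewrite tnth_mktuple leNgt; apply/negP => h; apply: nb; right.
  exact: h.
- exact: (hz jj).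
set Pj := \prod_(l < n) normc (x i k - tnth (zvec j w) l) in P0 lnP *.
set Pj' := \prod_(l < n) normc (x i k - tnth (zvec j.+1 w) l).
move=> lo up.
have lo' : K^-1 * Pj <= Pj'.
  rewrite (le_trans _ lo)// ler_wpM2r ?(ltW P0)// (le_trans Klo)//.
  rewrite ler_wpM2r ?invr_ge0 ?mulr_ge0 ?(ltW t0) ?(ltW n0)//.
  rewrite ler_wpM2r ?(ltW eps0)// ler_wpM2l ?(ltW D0)//.
  rewrite lef_pV2 ?posrE; [by rewrite lerD2l ler_wpM2l|..].
    by rewrite ltr_pwDl// mulr_ge0// (le_trans x0).
  by rewrite ltr_pwDl// mulr_ge0.
have up' : Pj' <= K * Pj.
  rewrite (le_trans up)// ler_wpM2r ?(ltW P0)// (le_trans _ Kup)// lerD2l.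
  by rewrite ler_wpM2r ?invr_ge0 ?(ltW D0)// ler_wpM2l.
have P'0 : 0 < Pj' by rewrite (lt_le_trans _ lo')// mulr_gt0// invr_gt0.
split => //.
have lnlo : - ln K + ln Pj <= ln Pj'.
  by rewrite -lnV ?posrE// -lnM ?posrE ?invr_gt0// ler_ln ?posrE// mulr_gt0// invr_gt0.
have lnup : ln Pj' <= ln K + ln Pj.
  by rewrite -lnM ?posrE// ler_ln ?posrE// mulr_gt0.
move: lnP; rewrite -natr1 mulrDl mul1r !ler_norml => /andP[l1 l2].
by apply/andP; split; lra.
Qed.

(** The exceptional event is the union of a null set, of the event that some weight
    exceeds [t], and of the event that every radius of the grid is bad. Replacing
    the chosen radius by [rho] costs at most [M * D / rho] for each zero. *)
Lemma failure_set : exists2 F : set Omega, measurable F &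
  (P F <= ((m * n)%:R * tau + v / M%:R)%:E)%E /\ forall w, ~ F w ->
  `|\sum_(l < n) circle_potential c rho (Z m l w) -
    \sum_(l < n) circle_potential c rho (Z 0%N l w)| <=
  m%:R * ln K + 2 * ln B + 2 * n%:R * (M%:R * D / rho).
Proof.
have [mA PA] := small_family_all M0 bad_small.
have [_ _ hF] := iterZ.
have : {ae P, forall w, (forall p : 'I_m * 'I_n, 0 < gam p.1.+1 p.2 w) /\
    (forall jj : 'I_m,
    size (circular_poly (zvec jj w) (gvec jj.+1 w)) = n.+1 ->
    lists_zeros (circular_poly (zvec jj w) (gvec jj.+1 w)) (zvec jj.+1 w))}.
  apply: filterI.
    apply: (@filter_forall _ _ (fun (p : 'I_m * 'I_n) w => 0 < gam p.1.+1 p.2 w)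
      (almost_everywhere P)) => -[jj k].
    exists (gam jj.+1 k @^-1` `]-oo, 0]); split.
    - by rewrite -[X in measurable X]setTI; exact: measurable_funP.
    - exact: gpos.
    - by move=> w /= /negP; rewrite -leNgt in_itv/=.
  apply: (@filter_forall _ _ (fun (jj : 'I_m) w =>
    size (circular_poly (zvec jj w) (gvec jj.+1 w)) = n.+1 ->
    lists_zeros (circular_poly (zvec jj w) (gvec jj.+1 w)) (zvec jj.+1 w))
    (almost_everywhere P)) => jj.
  have [|F mF] := hF jj.+1; first by rewrite ltn0Sn/=.
  by apply: filterS => w [].
move=> [N [mN N0 hN]].
pose G := \bigcup_(p in [set: 'I_m * 'I_n]) (gam p.1.+1 p.2 @^-1` `]t, +oo[).
have mG1 (p : 'I_m * 'I_n) : measurable (gam p.1.+1 p.2 @^-1` `]t, +oo[).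
  by rewrite -[X in measurable X]setTI; exact: measurable_funP.
have mG : measurable G.
  by apply: fin_bigcup_measurable => //; exact: finite_finset.
have PG : (P G <= ((m * n)%:R * tau)%:E)%E.
  have [] := @small_family_exists _ _ _ P 1 _ tau
    (fun (p : 'I_m * 'I_n) _ => gam p.1.+1 p.2 @^-1` `]t, +oo[).
    move=> p; apply: (small_family_const (q := tau)) => //; last by rewrite mul1r.
  rewrite big_ord1 card_prod !card_ord => _; congr (_ <= _)%E; congr (P _).
  by apply/seteqP; split => [w [p]|w [p _]]; exists p.
exists (N `|` (G `|` [set w | forall i, (i < M)%N -> bad i w])).
  by apply: measurableU => //; exact: measurableU.
split.
  apply: (le_trans (measureU2 _ mN _)); first exact: measurableU.
  rewrite [X in (X + _)%E](_ : _ = 0%E); last exact: N0.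
  rewrite add0e (le_trans (measureU2 _ mG mA))// EFinD.
  exact: leeD.
move=> w nF.
have [g0 hz] : (forall p : 'I_m * 'I_n, 0 < gam p.1.+1 p.2 w) /\
    (forall jj : 'I_m,
    size (circular_poly (zvec jj w) (gvec jj.+1 w)) = n.+1 ->
    lists_zeros (circular_poly (zvec jj w) (gvec jj.+1 w)) (zvec jj.+1 w)).
  by apply: contrapT => h; apply: nF; left; exact: hN.
have gt (jj : 'I_m) k : gam jj.+1 k w <= t.
  rewrite leNgt; apply/negP => h; apply: nF; right; left.
  by exists (jj, k) => //=; rewrite in_itv/= h.
have [i [iM nbad]] : exists i, (i < M)%N /\ ~ bad i w.
  apply: contrapT => h; apply: nF; right; right => i iM.
  by apply: contrapT => h'; apply: h; exists i.
have chain := chain_bound iM nbad (fun jj k => g0 (jj, k)) gt hz.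
have ri0 : 0 < r i by rewrite /r ltr_pwDl// mulr_ge0// ltW.
have iMR : i%:R <= M%:R :> R by rewrite ler_nat ltnW.
have n0 : (0 < n)%N by rewrite (leq_trans _ (ltn_ord k0)).
have B2' : (r i + D) / D <= B.
  rewrite (le_trans _ Bup)// ler_wpM2r ?invr_ge0 ?(ltW D0)// lerD2r lerD2l.
  by rewrite ler_wpM2r// ltW.
have main := @circle_potential_close R n (zvec 0 w) (zvec m w) om c (r i) D
  (m%:R * ln K) B om1 omE n0 ri0 D0 B2 B2'.
have {}main : `|\sum_(l < n) circle_potential c (r i) (Z m l w) -
    \sum_(l < n) circle_potential c (r i) (Z 0%N l w)| <= m%:R * ln K + 2 * ln B.
  have := main; under eq_bigr do rewrite tnth_mktuple.
  under [in X in _ - X]eq_bigr do rewrite tnth_mktuple.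
  apply.
  - move=> l; rewrite tnth_mktuple leNgt; apply/negP => h; apply: nbad; right; left.
    by exists l.
  - move=> l; rewrite tnth_mktuple leNgt; apply/negP => h; apply: nbad; right; right.
    by exists l.
  - by move=> k; exact: (chain k m (leqnn m)).2.
have shift j : `|\sum_(l < n) circle_potential c (r i) (Z j l w) -
    \sum_(l < n) circle_potential c rho (Z j l w)| <= n%:R * (M%:R * D / rho).
  rewrite -sumrB (le_trans (ler_norm_sum _ _ _))//.
  have -> : n%:R * (M%:R * D / rho) = \sum_(l < n) (M%:R * D / rho).
    by rewrite sumr_const card_ord mulr_natl.
  apply: ler_sum => l _; rewrite (le_trans (circle_potential_radius _ _ rho0 _))//.
    by rewrite /r lerDl mulr_ge0// ltW.
  rewrite /r mulrDl divff ?gt_eqF// addrAC subrr add0r.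
  by rewrite ler_wpM2r ?invr_ge0 ?(ltW rho0)// ler_wpM2r// ltW.
have sm := shift m; have s0 := shift 0%N.
move: main sm s0; rewrite !ler_norml => /andP[a1 a2] /andP[b1 b2] /andP[c1 c2].
by apply/andP; split; lra.
Qed.

End failure_set.

(** * Almost sure closeness of the potentials *)

Section borel_cantelli.
Context {R : realType} {d : measure_display} {T : measurableType d}.
Variable P : probability T R.

Lemma sum_inv_sq_le (C : R) (N : nat) : 0 <= C ->
  \sum_(0 <= k < N) C / k%:R ^+ 2 <= 2 * C.
Proof.
move=> C0.
suff H : \sum_(0 <= k < N.+2) C / k%:R ^+ 2 <= C * (2 - N.+1%:R^-1).
  apply: (@le_trans _ _ (\sum_(0 <= k < N.+2) C / k%:R ^+ 2)).
    rewrite [leRHS](big_cat_nat (n := N))//=; last by rewrite ltnW.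
    by rewrite lerDl sumr_ge0// => k _; rewrite divr_ge0// sqr_ge0.
  by rewrite (le_trans H)// mulrC ler_wpM2r// gerBl invr_ge0.
elim: N => [|N ih].
  by rewrite !big_nat_recl// big_geq// expr0n/= invr0 mulr0 expr1n; lra.
rewrite big_nat_recr//= (le_trans (lerD ih (lexx _)))// -mulrDr ler_wpM2l//.
have a0 : 0 < N.+1%:R :> R by rewrite ltr0n.
have -> : N.+2%:R = N.+1%:R + 1 :> R by rewrite natr1.
move: (N.+1%:R) a0 => a a0.
have a1 : 0 < a + 1 by rewrite addr_gt0.
rewrite -addrA lerD2l -subr_le0 opprK.
have -> : - a^-1 + (a + 1) ^- 2 + (a + 1)^-1 = - (a * (a + 1) ^+ 2)^-1.
  by field; rewrite !gt_eqF.
by rewrite oppr_le0 invr_ge0 mulr_ge0// ?(ltW a0)// sqr_ge0.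
Qed.

(** Once the exceptional events are chosen as a sequence, this follows from the
    convergence of the series of the [C / n ^+ 2]. *)
Lemma borel_cantelli_inv_sq (Q : nat -> T -> Prop) (C : R) (n0 : nat) : 0 <= C ->
  (forall n, (n0 <= n)%N -> exists2 F : set T, measurable F &
     (P F <= (C / n%:R ^+ 2)%:E)%E /\ forall w, ~ F w -> Q n w) ->
  {ae P, forall w, exists n1, forall n, (n1 <= n)%N -> Q n w}.
Proof.
move=> C0 h.
have /choice[F hF] : forall n, exists F : set T, [/\ measurable F,
    (P F <= (C / n%:R ^+ 2)%:E)%E & (n0 <= n)%N -> forall w, ~ F w -> Q n w].
  move=> n; have [n0n|nn0] := leqP n0 n.
    by have [F mF [PF QF]] := h n n0n; exists F.
  exists set0; split => //.
  by rewrite measure0 lee_fin divr_ge0// sqr_ge0.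
exists (lim_sup_set F); split.
- apply: bigcap_measurable; first by exists 0%N.
  by move=> k _; apply: bigcup_measurable => j _; have [] := hF j.
- apply: lim_sup_set_cvg0; first by move=> k; have [] := hF k.
  apply: (@le_lt_trans _ _ (2 * C)%:E); last exact: ltry.
  apply: lime_le; first exact: is_cvg_nneseries.
  apply: nearW => N.
  apply: (@le_trans _ _ (\sum_(0 <= k < N) (C / k%:R ^+ 2)%:E)%E).
    by apply: lee_sum => k _; have [] := hF k.
  by rewrite sumEFin lee_fin sum_inv_sq_le.
- move=> w /= nQ n _.
  apply: contrapT => nF; apply: nQ; exists (maxn n n0) => k.
  rewrite geq_max => /andP[nk n0k]; have [_ _ + ] := hF k.
  by move=> /(_ n0k); apply => Fk; apply: nF; exists k.
Qed.

End borel_cantelli.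

Section potentials_stay_close.
Context {R : realType} {d : measure_display} {Omega : measurableType d}.
Variable P : probability Omega R.
Variables (beta : R) (m : nat -> nat).
Variables (gam : forall n : nat, nat -> 'I_n -> {RV P >-> R})
  (Z : forall n : nat, nat -> 'I_n -> {RV P >-> R[i]}).
Arguments gam : clear implicits.
Arguments Z : clear implicits.
Hypothesis beta0 : 0 < beta.
Hypothesis mn : forall n, (2 <= n)%N -> (1 <= m n <= n.-1)%N.
Hypothesis iterZ : forall n, (2 <= n)%N ->
  iterated_circular_derivatives P (m n) beta (gam n) (Z n).

(** Everything is polynomial in [n]: the spacing of the radii is [rho / n ^+ 7], the
    weights are bounded by [n ^+ 5], and they must stay at distance [n ^- p / 3]
    from the critical values, where [p] is so large that this fails with
    probability at most [n ^- 6]. *)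
Lemma potentials_close_probability (c : R[i]) (rho : R) : 0 < rho ->
  exists n0 : nat, exists2 C : R, 0 <= C & exists2 K : R, 0 <= K &
  forall n, (n0 <= n)%N -> exists2 F : set Omega, measurable F &
    (P F <= (C / n%:R ^+ 2)%:E)%E /\ forall w, ~ F w ->
    `|\sum_(l < n) circle_potential c rho (Z n (m n) l w) -
      \sum_(l < n) circle_potential c rho (Z n 0%N l w)| <=
    K * ((m n)%:R * ln n%:R).
Proof.
move=> rho0.
have b2 : 0 < beta / 2 by rewrite divr_gt0.
have [k kpos [Cq Cq0 hCq]] := gamma_measure_itv b2.
have [Ct Ct0 hCt] := gamma_law_tail b2.
have [p pk] : exists p : nat, 7 <= p%:R * k.
  by exists (Num.truncn (7 / k)).+1; rewrite -ler_pdivrMr// ltW// truncnS_gt.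
pose X := normc c + (rho + rho).
have X0 : 0 <= X.
  by apply: addr_ge0; [exact: normc_ge0|apply: addr_ge0; exact: ltW].
pose n0 := maxn 3 (maxn (Num.truncn (expR 1 : R)).+1
  (maxn (Num.truncn Cq).+1 (Num.truncn (1 + 2 * X / rho)).+1)).
exists n0, (Ct + 9); first by rewrite addr_ge0// ltW.
exists (p%:R + 33); first by rewrite addr_ge0.
move=> n; rewrite !geq_max => /andP[n3 /andP[ne /andP[nCq nX]]].
have n2 : (2 <= n)%N by exact: ltnW.
set N : R := n%:R.
have N3 : 3 <= N by rewrite (ler_nat R 3).
have big x : (Num.truncn x < n)%N -> x <= N.
  by move=> xn; rewrite ltW// (lt_le_trans (truncnS_gt _))// ler_nat.
have {}ne := big _ ne; have {}nCq := big _ nCq; have {}nX := big _ nX.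
have N0 : 0 < N by lra.
have N1 : 1 <= N by lra.
have lnN1 : 1 <= ln N by rewrite -(@expRK R 1) ler_ln ?posrE// expR_gt0.
have N00 : N != 0 by rewrite gt_eqF.
have Nx i : 0 < N ^+ i by rewrite exprn_gt0.
have Nle i j : (i <= j)%N -> N ^+ i <= N ^+ j by move=> ij; rewrite ler_weXn2l.
have [gI gY hF] := iterZ n2.
have lawE (jj : 'I_(m n)) (l : 'I_n) A : measurable A ->
    P (gam n jj.+1 l @^-1` A) = gamma_law (beta / 2) A.
  by move=> mA; have := gI.2 (jj, l) A mA.
have /andP[m1 mn'] := mn n2.
have mN : (m n)%:R <= N by rewrite ler_nat (leq_trans mn')// leq_pred.
have mR1 : 1 <= (m n)%:R :> R by rewrite (ler_nat R 1).
pose M := (n ^ 6)%N.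
have MN : M%:R = N ^+ 6 by rewrite natrX.
pose D := rho / N ^+ 7.
have D0 : 0 < D by rewrite divr_gt0.
have MD : M%:R * D = rho / N by rewrite MN /D; field.
have MDr : M%:R * D <= rho by rewrite MD ler_pdivrMr// ler_peMr// ltW.
have Dr : D <= rho by rewrite /D ler_pdivrMr// ler_peMr ?(ltW rho0)// exprn_ege1.
pose eps := (N ^+ p)^-1 / 3.
have eps0 : 0 < eps by rewrite divr_gt0// invr_gt0.
have eps3 : 3 * eps = (N ^+ p)^-1 by rewrite /eps mulrCA divff ?mulr1.
(* The near-critical events of one weight have total probability at most 1 over the grid. *)
pose q := (N ^+ 6)^-1.
have q0 : 0 <= q by rewrite invr_ge0 ltW.
have n0' : (0 < n)%N by rewrite (leq_trans _ n3).
have [om om1 omE] := unity_roots (R := R) n0'.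
have gpos (jj : 'I_(m n)) (l : 'I_n) : P (gam n jj.+1 l @^-1` `]-oo, 0]) = 0%E.
  by rewrite lawE// gamma_law_nonpos.
have gtau (jj : 'I_(m n)) (l : 'I_n) :
    (P (gam n jj.+1 l @^-1` `](N ^+ 5)%R, +oo[) <= (Ct / N ^+ 5)%:E)%E.
  by rewrite lawE//; exact: hCt.
have gq (jj : 'I_(m n)) (l : 'I_n) y :
    (P (gam n jj.+1 l @^-1` `[y, (y + 3 * eps)%R]) <= q%:E)%E.
  have yy : y < y + 3 * eps by rewrite ltrDl mulr_gt0.
  have := hCq (distribution P (gam n jj.+1 l)) (lawE jj l) _ _ yy.
  move=> /le_trans; apply; rewrite lee_fin addrAC subrr add0r eps3.
  have -> : (N ^+ p)^-1 `^ k = N `^ (- (p%:R * k)).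
    by rewrite -powR_invn ?(ltW N0)// -powRrM mulNr.
  apply: (@le_trans _ _ (N * N `^ (- 7))).
    apply: ler_pM => //; [exact: ltW|exact: powR_ge0|].
    by apply: ler_powR => //; rewrite lerN2.
  rewrite powR_invn ?(ltW N0)// /q.
  have -> : N * N ^- 7 = (N ^+ 6)^-1 by field.
  by [].
have NX : rho + 2 * X <= N * rho.
  have -> : rho + 2 * X = (1 + 2 * X / rho) * rho by field; rewrite gt_eqF.
  by rewrite ler_wpM2r// ltW.
pose K := N ^+ (p + 15).
have K1 : 1 <= K by rewrite exprn_ege1.
have Kup : 1 + 2 * X / D <= K.
  apply: (@le_trans _ _ (N ^+ 8)); last by apply: Nle; apply: (@leq_trans 15); rewrite ?leq_addl.
  have -> : 2 * X / D = 2 * X * N ^+ 7 / rho by rewrite /D; field; rewrite !gt_eqF.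
  rewrite -lerBrDl ler_pdivrMr//.
  have := ler_wpM2r (ltW (Nx 7)) NX.
  have : rho <= rho * N ^+ 7 by rewrite ler_peMr ?(ltW rho0)// exprn_ege1.
  rewrite [N ^+ 8]exprS; move: (N ^+ 7) => y h7.
  by rewrite mulrBl mul1r mulrDl mulrAC => h; lra.
have Klo : K^-1 <= D / (D + 2 * X) * eps / (n%:R * N ^+ 5).
  have DX : N ^- 8 <= D / (D + 2 * X).
    apply: (@le_trans _ _ (D / (rho + 2 * X))); last first.
      rewrite ler_wpM2l ?(ltW D0)// lef_pV2 ?posrE ?lerD2r//.
        by rewrite ltr_pwDl// mulr_ge0.
      by rewrite ltr_pwDl// mulr_ge0.
    rewrite ler_pdivlMr; last by rewrite ltr_pwDl// mulr_ge0.
    apply: (@le_trans _ _ (N ^- 8 * (N * rho))).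
      by rewrite ler_wpM2l// invr_ge0 ltW.
    by rewrite /D le_eqVlt; apply/orP; left; apply/eqP; field.
  have epsN : N ^- (p + 1) <= eps.
    rewrite /eps exprD expr1 invfM ler_wpM2l ?invr_ge0 ?(ltW (Nx p))//.
    by rewrite lef_pV2 ?posrE.
  have KE : K = N ^+ 8 * N ^+ (p + 1) * (n%:R * N ^+ 5).
    by rewrite /K (_ : p + 15 = 8 + (p + 1) + 6)%N ?[in LHS]exprD ?exprD ?exprS//; ring.
  rewrite KE [(_ * (n%:R * _))^-1]invfM [(_ * N ^+ (p + 1))^-1]invfM.
  rewrite ler_wpM2r ?invr_ge0 ?mulr_ge0 ?(ltW (Nx _))//.
  by rewrite ler_pM// invr_ge0 ltW.
pose B := N ^+ 8.
have B2 : 2 <= B.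
  by apply: (@le_trans _ _ (N ^+ 1)); [rewrite expr1; lra|exact: Nle].
have Bup : (rho + M%:R * D + D) / D <= B.
  rewrite ler_pdivrMr//; apply: (@le_trans _ _ (rho * 3)); last first.
    apply: (@le_trans _ _ (rho * N)); first by rewrite ler_wpM2l// ltW.
    by rewrite /B /D le_eqVlt; apply/orP; left; apply/eqP; field.
  by lra.
have cX : normc c + (rho + M%:R * D) <= X by rewrite lerD2l lerD2l.
have Mq : M%:R * q <= 1 by rewrite MN /q divff// expf_neq0.
have M0 : (0 < M)%N by rewrite expn_gt0 n0'.
have [F mF [PF hFw]] := failure_set (iterZ n2) (Ordinal n0') om1 omE
  rho0 D0 eps0 (Nx 5%N) M0 q0 Mq gpos gq gtau cX K1 Kup Klo B2 Bup.
exists F => //; split.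
  apply: (le_trans PF); rewrite lee_fin natrM -/N MN.
  have m0 : 0 <= (m n)%:R :> R by exact: le_trans mR1.
  apply: (@le_trans _ _ (N * N * (Ct / N ^+ 5) +
      (N * N * (N * 2 + 2 + 1) + (N * 2 + N * 2)) / N ^+ 6)).
    apply: lerD.
      apply: ler_wpM2r; first by rewrite divr_ge0// ltW.
      by apply: ler_wpM2r => //; exact: ltW.
    apply: ler_wpM2r; first by rewrite invr_ge0 ltW.
    rewrite lerD2r; apply: ler_wpM2r; first by rewrite !addr_ge0// mulr_ge0// ltW.
    by apply: ler_wpM2r => //; exact: ltW.
  have -> : N * N * (Ct / N ^+ 5) = (Ct / N) / N ^+ 2 by field.
  have -> : (N * N * (N * 2 + 2 + 1) + (N * 2 + N * 2)) / N ^+ 6 =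
    ((N * N * (N * 2 + 2 + 1) + (N * 2 + N * 2)) / N ^+ 4) / N ^+ 2 by field.
  rewrite -mulrDl ler_wpM2r ?invr_ge0 ?(ltW (Nx _))// lerD//.
    by rewrite ler_pdivrMr// ler_peMr// ltW.
  rewrite ler_pdivrMr//.
  have -> : N ^+ 4 = N * N * (N * N) by ring.
  have NN : N <= N * N by rewrite ler_peMr// ltW.
  have NNN : N * (N * N) <= N * N * (N * N) by rewrite ler_wpM2r// mulr_ge0// ltW.
  have NN1 : N * N <= N * (N * N) by rewrite ler_wpM2l// ltW.
  have -> : N * N * (N * 2 + 2 + 1) + (N * 2 + N * 2) = 2 * (N * (N * N)) + 3 * (N * N) + 4 * N by ring.
  by lra.
move=> w /hFw /le_trans; apply.
rewrite /K /B !lnXn// -[ln N *+ (p + 15)]mulr_natr -[ln N *+ 8]mulr_natr MD.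
have -> : 2 * n%:R * (rho / N / rho) = 2 :> R.
  by rewrite -/N; field; rewrite !gt_eqF.
have ml : ln N <= (m n)%:R * ln N by rewrite ler_peMl// (le_trans _ lnN1).
rewrite -/N natrD; set l := ln N in lnN1 ml *; set mm := (m n)%:R in ml *.
have -> : mm * (l * (p%:R + 15)) = (p%:R + 15) * (mm * l) by ring.
have -> : (p%:R + 33) * (mm * l) = (p%:R + 15) * (mm * l) + 18 * (mm * l) by ring.
by rewrite -addrA lerD2l; lra.
Qed.

Lemma potentials_close_ae (c : R[i]) (rho : R) : 0 < rho ->
  (m n)%:R / (n%:R / ln n%:R) @[n --> \oo] --> (0 : R) ->
  {ae P, forall w,
    (n%:R^-1 * (\sum_(l < n) circle_potential c rho (Z n (m n) l w) -
      \sum_(l < n) circle_potential c rho (Z n 0%N l w))) @[n --> \oo] --> (0 : R)}.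
Proof.
move=> rho0 mlim.
have [n0 [C C0 [K K0 h]]] := potentials_close_probability c rho0.
have := borel_cantelli_inv_sq C0 h.
apply: filterS => w [n1 hn1].
have Klim : K * ((m n)%:R / (n%:R / ln n%:R)) @[n --> \oo] --> (0 : R).
  by rewrite -(mulr0 K); apply: cvgMr.
apply/cvgr0Pnorm_lt => e e0.
move/cvgr0Pnorm_lt : Klim => /(_ e e0) => H.
near=> n.
have n1n : (n1 <= n)%N by near: n; exists n1.
have nlt : `|K * ((m n)%:R / (n%:R / ln n%:R))| < e by near: n.
apply: le_lt_trans nlt.
rewrite normrM ger0_norm ?invr_ge0//.
apply: (@le_trans _ _ (n%:R^-1 * (K * ((m n)%:R * ln n%:R)))).
  by rewrite ler_wpM2l ?invr_ge0// hn1.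
have -> : n%:R^-1 * (K * ((m n)%:R * ln n%:R)) = K * ((m n)%:R / (n%:R / ln n%:R)).
  by rewrite invfM invrK; ring.
exact: ler_norm.
Unshelve. all: by end_near. Qed.

End potentials_stay_close.

(** * Averages over independent samples *)

Section bounded_integrals.
Context {R : realType} {d : measure_display} {T : measurableType d}.
Variable mu : probability T R.

Lemma bounded_integrable (f : T -> R) (a b : R) : measurable_fun setT f ->
  (forall x, a <= f x <= b) -> mu.-integrable setT (EFin \o f).
Proof.
move=> mf fab; apply: measurable_bounded_integrable => //.
  by rewrite (le_lt_trans (probability_le1 _ _))// ltry.
exists (`|a| + `|b|); split; first by rewrite num_real.
move=> M abM x _ /=; rewrite ltW// (le_lt_trans _ abM)//.
have /andP[h1 h2] := fab x; rewrite ler_norml; apply/andP; split.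
  rewrite (le_trans _ h1)// lerNl (le_trans (ler_norm _))// normrN lerDl//.
by rewrite (le_trans h2)// (le_trans (ler_norm _))// lerDr.
Qed.

Lemma le_Rintegral_prob (f g : T -> R) (a b a' b' : R) : measurable_fun setT f ->
  measurable_fun setT g -> (forall w, a <= f w <= b) -> (forall w, a' <= g w <= b') ->
  (forall w, f w <= g w) -> \int[mu]_w f w <= \int[mu]_w g w.
Proof.
move=> mf mg fb gb fg; apply: le_Rintegral => //.
  exact: bounded_integrable fb.
exact: bounded_integrable gb.
Qed.

Lemma Rintegral_cst_prob (r : R) : \int[mu]_x r = r.
Proof.
transitivity (r * fine (mu setT)); first exact: Rintegral_cst.
by rewrite probability_setT mulr1.
Qed.

End bounded_integrals.

Section frequencies.
Context {R : realType} {d : measure_display} {T : measurableType d}.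
Variable P : probability T R.

Section binomial_tail.
Variables (n : nat) (A : 'I_n -> set T) (q : R).
Hypotheses (mA : forall i, measurable (A i))
  (indA : forall J : {set 'I_n}, P (\bigcap_(i in [set` J]) A i) =
     (\prod_(i in J) q%:E)%E).

(** Expanding the product over the subsets [J] of the indices turns the expectation
    into the sum of [x ^+ #|J|] times the probability of the intersection over
    [J], which is exactly what mutual independence computes. *)
Lemma expectation_prod_1D_indic (x : R) : 0 <= x -> 0 <= q ->
  (\int[P]_w (\prod_(i < n) (1 + x * \1_(A i) w))%:E = ((1 + x * q) ^+ n)%:E)%E.
Proof.
move=> x0 q0.
have E1 w : \prod_(i < n) (1 + x * \1_(A i) w) =
    \sum_(J : {set 'I_n}) x ^+ #|J| * \1_(\bigcap_(i in [set` J]) A i) w.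
  under eq_bigr do rewrite addrC.
  rewrite bigA_distr; apply: eq_bigr => J _.
  rewrite -big_mkcond/= big_split/= prodr_const; congr (_ * _).
  rewrite [RHS]indicE; case: (boolP (w \in _)) => [|nw].
    rewrite inE => h; rewrite big1// => i iJ.
    by rewrite indicE mem_set//; exact: h.
  have [i iJ nA] : exists2 i, i \in J & ~ A i w.
    apply: contrapT => h; move/negP: nw; apply; rewrite inE => i /= iJ.
    by apply: contrapT => nA; apply: h; exists i.
  by rewrite (bigD1 i)//= indicE memNset// mul0r.
have mI (J : {set 'I_n}) : measurable (\bigcap_(i in [set` J]) A i).
  by apply: fin_bigcap_measurable.
rewrite (eq_integral (fun w => \sum_(J : {set 'I_n})
    (x ^+ #|J| * \1_(\bigcap_(i in [set` J]) A i) w)%:E)%E); last first.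
  by move=> w _; rewrite E1 sumEFin.
rewrite ge0_integral_sum//; last 2 first.
- by move=> J; apply/measurable_EFinP; apply: measurable_funM => //.
- by move=> J w _; rewrite lee_fin mulr_ge0// exprn_ge0.
have -> : (1 + x * q) ^+ n = \prod_(i < n) (x * q + 1).
  by rewrite prodr_const card_ord addrC.
rewrite bigA_distr -sumEFin; apply: eq_bigr => J _.
under eq_integral do rewrite EFinM.
rewrite ge0_integralZl_EFin ?exprn_ge0//; last first.
  by apply/measurable_EFinP; apply: measurable_indic; exact: mI.
rewrite integral_indic// setIT [X in (_ * X)%E](_ : _ = \prod_(i in J) q%:E)%E; last exact: indA.
rewrite prodEFin -EFinM; congr (_%:E).
by rewrite -big_mkcond/= big_split/= !prodr_const.
Qed.

(** Chernoff's bound with the factor [1 + x], [x = e / 2]. *)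
Lemma binomial_upper_tail (e : R) : 0 < e -> 0 <= q <= 1 ->
  let B := [set w | n%:R * (q + e) <= \sum_(i < n) \1_(A i) w] in
  measurable B /\
  (P B <= (expR (- (n%:R * (e ^+ 2 / (4 + 2 * e)))))%:E)%E.
Proof.
move=> e0 /andP[q0 q1] B.
have mS : measurable_fun setT (fun w => \sum_(i < n) (\1_(A i) w : R)).
  by apply: measurable_sum => i; exact: measurable_indic.
have mB : measurable B.
  rewrite (_ : B = (fun w => \sum_(i < n) (\1_(A i) w : R)) @^-1` `[n%:R * (q + e), +oo[).
    rewrite -[X in measurable X]setTI; apply: (mS measurableT).
    exact: measurable_itv.
  by apply/seteqP; split => w; rewrite /B/= in_itv/= andbT.
split => //.
pose x := e / 2.
have x0 : 0 < x by rewrite divr_gt0.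
have x1 : 0 < 1 + x by rewrite addr_gt0.
pose a := expR (n%:R * (q + e) * ln (1 + x)).
have a0 : 0 < a by rewrite expR_gt0.
(* Markov's inequality for the product of the [1 + x * \1_(A i)]. *)
have mk : (a%:E * P B <= ((1 + x * q) ^+ n)%:E)%E.
  rewrite -expectation_prod_1D_indic// ?(ltW x0)//.
  have -> : (a%:E * P B = \int[P]_w (a%:E * (\1_B w)%:E))%E.
    rewrite ge0_integralZl_EFin ?(ltW a0)//; last first.
      by apply/measurable_EFinP; exact: measurable_indic.
    by rewrite integral_indic// setIT.
  have prod0 w i : 0 < 1 + x * \1_(A i) w :> R.
    by rewrite ltr_pwDl// mulr_ge0// ltW.
  apply: ge0_le_integral => //.
  - by move=> w _; rewrite -EFinM lee_fin mulr_ge0// ltW.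
  - by apply: measurable_funeM; apply/measurable_EFinP; exact: measurable_indic.
  - apply/measurable_EFinP.
    apply: measurable_prod => i _; apply: measurable_funD => //.
    by apply: measurable_funM => //; exact: measurable_indic.
  - move=> w _; rewrite -EFinM lee_fin indicE.
    case: (boolP (w \in B)) => [|_]; last first.
      by rewrite mulr0 prodr_ge0// => i _; exact: ltW.
    rewrite inE /B/= mulr1 => hw.
    have -> : \prod_(i < n) (1 + x * \1_(A i) w) =
        expR (\sum_(i < n) \1_(A i) w * ln (1 + x)).
      rewrite expR_sum; apply: eq_bigr => i _; rewrite indicE.
      case: (_ \in _); first by rewrite mulr1 mul1r lnK.
      by rewrite mulr0 mul0r addr0 expR0.
    rewrite ler_expR -mulr_suml ler_wpM2r// ln_ge0//.
    by rewrite lerDl ltW.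
have fB : P B \is a fin_num by exact: fin_num_measure.
move: mk; rewrite -(fineK fB) -EFinM !lee_fin mulrC -ler_pdivlMr// => /le_trans; apply.
rewrite ler_pdivrMr// /a -expRD.
apply: (@le_trans _ _ (expR (n%:R * (x * q)))).
  rewrite expRM_natl lerXn2r// ?nnegrE ?expR_ge0//.
    by rewrite addr_ge0// mulr_ge0// ltW.
  exact: expR_ge1Dx.
rewrite ler_expR -mulrN -mulrA -mulrDr ler_wpM2l//.
have lnx : x / (1 + x) <= ln (1 + x).
  have h : ln (1 + x)^-1 <= (1 + x)^-1 - 1.
    rewrite -{1}(subrK 1 (1 + x)^-1) addrC le_ln1Dx//.
    by rewrite ltrBrDr addrC subrr invr_gt0.
  rewrite lnV ?posrE// in h.
  have -> : x / (1 + x) = 1 - (1 + x)^-1 by field; rewrite gt_eqF.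
  by lra.
apply: (@le_trans _ _ (- (e ^+ 2 / (4 + 2 * e)) + (q + e) * (x / (1 + x)))).
  have -> : - (e ^+ 2 / (4 + 2 * e)) + (q + e) * (x / (1 + x)) =
      x * q + (1 - q) * (x ^+ 2 / (1 + x)).
    by rewrite /x; field; rewrite !gt_eqF// addr_gt0// ?mulr_gt0.
  by rewrite lerDl mulr_ge0 ?subr_ge0// divr_ge0// ?(ltW x1)// sqr_ge0.
by rewrite lerD2l ler_wpM2l// addr_ge0// ltW.
Qed.

End binomial_tail.

Section lower_frequency.
Context {d' : measure_display} {V : measurableType d'}.
Variables (law : probability V R) (Z : forall n : nat, 'I_n -> {RV P >-> V}).
Arguments Z : clear implicits.
Hypothesis iidZ : forall n, (2 <= n)%N -> iid P (Z n) law.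

(** Applied to the complement of [U]: a bound for the upper tail of its frequency is
    a bound for the lower tail of the frequency of [U]. *)
Lemma frequency_lower_ae (U : set V) (e : R) : measurable U -> 0 < e ->
  {ae P, forall w, exists n1, forall n, (n1 <= n)%N ->
    n%:R * (fine (law U) - e) <= \sum_(k < n) (\1_U (Z n k w) : R)}.
Proof.
move=> mU e0.
have mUc := measurableC mU.
pose q := fine (law (~` U)).
have fq : law (~` U) \is a fin_num by exact: fin_num_measure.
have fU : law U \is a fin_num by exact: fin_num_measure.
have qU : q = 1 - fine (law U).
  by rewrite /q probability_setC// fineB// fine1.
have q01 : 0 <= q <= 1.
  rewrite /q fine_ge0//= -lee_fin fineK//; exact: probability_le1.
pose de := e ^+ 2 / (4 + 2 * e).
have de0 : 0 < de by rewrite divr_gt0 ?exprn_gt0// addr_gt0// mulr_gt0.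
apply: (@borel_cantelli_inv_sq _ _ _ P _ (2 / de ^+ 2) 2).
  by rewrite divr_ge0// sqr_ge0.
move=> n n2; have [indZ lawZ] := iidZ n2.
have mZ i B : measurable B -> measurable (Z n i @^-1` B).
  by move=> mB; rewrite -[X in measurable X]setTI; exact: measurable_funP.
have ind (J : {set 'I_n}) : P (\bigcap_(i in [set` J]) (Z n i @^-1` (~` U))) =
     (\prod_(i in J) q%:E)%E.
  rewrite (indZ J (fun=> ~` U))//; apply: eq_bigr => i _.
  by rewrite /q fineK//; exact: lawZ.
have [mB PB] := binomial_upper_tail (fun i => mZ i _ mUc) ind e0 q01.
exists [set w | n%:R * (q + e) <= \sum_(i < n) (\1_(Z n i @^-1` (~` U)) w : R)] => //.
split.
  apply: (le_trans PB); rewrite lee_fin -/de expRN.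
  have n0 : 0 < n%:R :> R by rewrite ltr0n (leq_trans _ n2).
  have nd : 0 <= n%:R * de by rewrite mulr_ge0 ?ltW.
  have h := expR_ge1Dxn 1 nd.
  rewrite -div1r ler_pdivrMr ?expR_gt0//.
  have dn0 : 0 < de ^+ 2 * n%:R ^+ 2 by rewrite mulr_gt0// exprn_gt0.
  have h2 : (de ^+ 2 * n%:R ^+ 2) / 2 <= expR (n%:R * de).
    by rewrite (le_trans _ h)// [(n%:R * de) ^+ _]exprMn [n%:R ^+ _ * _]mulrC lerDr.
  have -> : 2 / de ^+ 2 / n%:R ^+ 2 = 2 / (de ^+ 2 * n%:R ^+ 2).
    by rewrite [(de ^+ 2 * _)^-1]invfM mulrA.
  rewrite mulrAC ler_pdivlMr// mul1r.
  by rewrite -ler_pdivrMl// mulrC.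
move=> w /= /negP; rewrite -ltNge => hw.
have cE : \sum_(i < n) (\1_(Z n i @^-1` (~` U)) w : R) =
    n%:R - \sum_(k < n) (\1_U (Z n k w) : R).
  have -> : n%:R = \sum_(k < n) (1 : R) by rewrite sumr_const card_ord.
  rewrite -sumrB; apply: eq_bigr => i _; rewrite !indicE.
  have -> : (w \in Z n i @^-1` (~` U)) = ~~ (Z n i w \in U).
    by rewrite -in_setC; apply/idP/idP; rewrite !inE.
  by case: (_ \in _) => /=; rewrite ?subrr ?subr0.
move: hw; rewrite cE qU; set S := \sum_(k < n) _.
have -> : n%:R * (1 - fine (law U) + e) = n%:R - n%:R * (fine (law U) - e) by ring.
by rewrite ltrD2l ltrN2 => /ltW.
Qed.

End lower_frequency.
End frequencies.

Section law_of_large_numbers.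
Context {R : realType} {d : measure_display} {T : measurableType d}.
Variable P : probability T R.
Context {d' : measure_display} {V : measurableType d'}.
Variables (law : probability V R) (Z : forall n : nat, 'I_n -> {RV P >-> V}).
Arguments Z : clear implicits.
Hypothesis iidZ : forall n, (2 <= n)%N -> iid P (Z n) law.

Lemma sum_levels (L : nat) (y : R) : 0 <= y <= L%:R ->
  y - 1 <= \sum_(l < L) (l.+1%:R <= y)%R%:R <= y.
Proof.
move=> /andP[y0 yL].
pose t := Num.truncn y.
have -> : \sum_(l < L) (l.+1%:R <= y)%R%:R = t%:R :> R.
  have tL : (t <= L)%N by rewrite -ltnS truncn_lt_nat// -natr1 ltr_pwDr.
  have H N : \sum_(l < N) (l.+1%:R <= y)%R%:R = (minn N t)%:R :> R.
    elim: N => [|N ih]; first by rewrite big_ord0 min0n.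
    rewrite big_ord_recr/= ih -truncn_gt_nat -/t -natrD; congr (_%:R).
    by case: ltnP => h; lia.
  by rewrite H; congr (_%:R); lia.
have /andP[t1 t2] := truncn_itv y0.
by rewrite t1 andbT lerBlDr natr1 ltW.
Qed.

(** Up to [1 / L], [h] is the mean of the indicators of its [L] level sets. *)
Lemma average_lower_ae (h : V -> R) (e : R) : measurable_fun setT h ->
  (forall x, 0 <= h x <= 1) -> 0 < e ->
  {ae P, forall w, exists n1, forall n, (n1 <= n)%N ->
    \int[law]_x h x - e <= n%:R^-1 * \sum_(k < n) h (Z n k w)}.
Proof.
move=> mh h01 e0.
pose L := (Num.truncn (2 / e)).+1.
have eL : 2 / e < L%:R by exact: truncnS_gt.
have L0 : 0 < L%:R :> R by rewrite ltr0n.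
have L2 : 2 / L%:R <= e by rewrite ler_pdivrMr// mulrC -ler_pdivrMr// ltW.
pose U (l : 'I_L) := [set x | l.+1%:R <= L%:R * h x].
have mU l : measurable (U l).
  rewrite (_ : U l = (fun x => L%:R * h x) @^-1` `[l.+1%:R, +oo[).
    have mLh : measurable_fun setT (fun x => L%:R * h x) by exact: measurable_funM.
    rewrite -[X in measurable X]setTI; apply: (mLh measurableT).
    exact: measurable_itv.
  by apply/seteqP; split => x; rewrite /U/= in_itv/= andbT.
have lev x : L%:R * h x - 1 <= \sum_(l < L) (\1_(U l) x : R) <= L%:R * h x.
  have /andP[h0 h1] := h01 x.
  rewrite (eq_bigr (fun l : 'I_L => (l.+1%:R <= L%:R * h x)%R%:R)); last first.
    move=> l _; rewrite indicE; congr (_%:R); congr nat_of_bool.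
    by apply/idP/idP; rewrite inE.
  apply: sum_levels; rewrite mulr_ge0 ?(ltW L0)//=.
  by rewrite -[leRHS]mulr1 ler_wpM2l// ltW.
have Li0 : 0 < L%:R^-1 :> R by rewrite invr_gt0.
have Ih : \int[law]_x h x <= L%:R^-1 * (\sum_(l < L) fine (law (U l))) + L%:R^-1.
  have mS : measurable_fun setT (fun x => \sum_(l < L) (\1_(U l) x : R)).
    by apply: measurable_sum => l; exact: measurable_indic.
  have S0 x : 0 <= \sum_(l < L) (\1_(U l) x : R) by rewrite sumr_ge0.
  have SL x : \sum_(l < L) (\1_(U l) x : R) <= L%:R.
    have /andP[_ /le_trans] := lev x; apply.
    by rewrite -[leRHS]mulr1 ler_wpM2l ?(ltW L0)//; have /andP[] := h01 x.
  have iS : law.-integrable setT (EFin \o (fun x => \sum_(l < L) (\1_(U l) x : R))).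
    by apply: (bounded_integrable law (a := 0) (b := L%:R)) => // x; rewrite S0 SL.
  have IS : \int[law]_x (\sum_(l < L) (\1_(U l) x : R)) = \sum_(l < L) fine (law (U l)).
    rewrite /Rintegral.
    rewrite (eq_integral (fun x => \sum_(l < L) (\1_(U l) x)%:E)%E); last first.
      by move=> x _; rewrite sumEFin.
    rewrite ge0_integral_sum//; last first.
      by move=> l; apply/measurable_EFinP; exact: measurable_indic.
    rewrite (eq_bigr (fun l => (fine (law (U l)))%:E)) ?sumEFin// => l _.
    by rewrite integral_indic// setIT fineK// fin_num_measure.
  rewrite -IS -[X in _ + X](Rintegral_cst_prob law).
  rewrite -RintegralZl// -RintegralD//; last 2 first.
  - apply: (bounded_integrable law (a := 0) (b := L%:R^-1 * L%:R)).
      exact: measurable_funM.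
    by move=> x; rewrite mulr_ge0 ?(ltW Li0)//= ler_wpM2l ?(ltW Li0).
  - by apply: (bounded_integrable law (a := L%:R^-1) (b := L%:R^-1)) => // x; rewrite lexx.
  apply: (le_Rintegral_prob law (a := 0) (b := 1) (a' := 0) (b' := L%:R^-1 * L%:R + L%:R^-1)) => //.
  - by apply: measurable_funD => //; exact: measurable_funM.
  - move=> x; rewrite addr_ge0 ?mulr_ge0 ?(ltW Li0)//= lerD2r.
    by rewrite ler_wpM2l ?(ltW Li0).
  - move=> x; have /andP[+ _] := lev x.
    by rewrite -[X in _ <= _ + X]mulr1 -mulrDr ler_pdivlMl// -lerBlDr.
have lawU l : {ae P, forall w, exists n1, forall n, (n1 <= n)%N ->
    n%:R * (fine (law (U l)) - L%:R^-1) <= \sum_(k < n) (\1_(U l) (Z n k w) : R)}.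
  exact: frequency_lower_ae.
have lawUall : {ae P, forall w, forall l, exists n1, forall n, (n1 <= n)%N ->
    n%:R * (fine (law (U l)) - L%:R^-1) <= \sum_(k < n) (\1_(U l) (Z n k w) : R)}.
  exact: (@filter_forall _ _ (fun (l : 'I_L) w => exists n1, forall n, (n1 <= n)%N ->
    n%:R * (fine (law (U l)) - L%:R^-1) <= \sum_(k < n) (\1_(U l) (Z n k w) : R))
    (almost_everywhere P)).
apply: filterS lawUall => w /choice[N hN].
exists (maxn 1 (\max_(l < L) N l)) => n; rewrite geq_max => /andP[n1 nN].
have n0 : 0 < n%:R :> R by rewrite ltr0n.
have hl l : fine (law (U l)) - L%:R^-1 <= n%:R^-1 * \sum_(k < n) (\1_(U l) (Z n k w) : R).
  rewrite ler_pdivlMl// mulrC mulrC hN// (leq_trans _ nN)//.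
  exact: (leq_bigmax l).
apply: (@le_trans _ _ (L%:R^-1 * \sum_(l < L) (fine (law (U l)) - L%:R^-1))).
  rewrite sumrB sumr_const card_ord -[L%:R^-1 *+ L]mulr_natl divff ?gt_eqF//.
  rewrite mulrBr mulr1.
  have : L%:R^-1 + L%:R^-1 <= e by rewrite -mulr2n -[_ *+ 2]mulr_natl.
  by lra.
apply: (@le_trans _ _ (L%:R^-1 * \sum_(l < L) (n%:R^-1 * \sum_(k < n) (\1_(U l) (Z n k w) : R)))).
  by rewrite ler_wpM2l ?(ltW Li0)// ler_sum.
rewrite -mulr_sumr mulrCA ler_wpM2l ?invr_ge0 ?(ltW n0)// exchange_big/= mulr_sumr.
apply: ler_sum => k _.
by rewrite ler_pdivrMl//; have /andP[] := lev (Z n k w).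
Qed.

End law_of_large_numbers.

(** * Tents *)

Section tents.
Context {R : realType}.
Implicit Types (c w : R[i]) (rho : R).

(** Both potentials are [ln |w - c|] far from [c], which makes the difference
    compactly supported. *)
Definition tent c rho w : R :=
  (circle_potential c (2 * rho) w - circle_potential c rho w) / ln 2.

Lemma ln2_gt0 : 0 < ln 2 :> R. Proof. by rewrite ln_gt0// ltr1n. Qed.

Lemma tent_ge0 c rho w : 0 < rho -> 0 <= tent c rho w.
Proof.
move=> r0; rewrite /tent divr_ge0 ?(ltW ln2_gt0)// subr_ge0 /circle_potential.
rewrite ler_ln ?posrE ?lt_max ?r0 ?mulr_gt0//.
by rewrite ge_max !le_max lexx orbT andbT ler_peMl ?ler1n// ltW.
Qed.

Lemma tent_le1 c rho w : 0 < rho -> tent c rho w <= 1.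
Proof.
move=> r0; rewrite /tent ler_pdivrMr ?ln2_gt0// mul1r lerBlDr /circle_potential.
have r2 : 0 < Num.max rho (normc (w - c)) by rewrite lt_max r0.
have r4 : 0 < Num.max (2 * rho) (normc (w - c)) by rewrite lt_max mulr_gt0.
rewrite -lnM ?posrE// ler_ln ?posrE ?mulr_gt0//.
rewrite ge_max; apply/andP; split.
  by rewrite ler_pM2l// le_max lexx.
rewrite (@le_trans _ _ (Num.max rho (normc (w - c))))//.
  by rewrite le_max lexx orbT.
by rewrite ler_peMl ?ler1n// ltW.
Qed.

Lemma tent_eq1 c rho w : 0 < rho -> normc (w - c) <= rho -> tent c rho w = 1.
Proof.
move=> r0 h; rewrite /tent /circle_potential.
have -> : Num.max rho (normc (w - c)) = rho by apply/max_idPl.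
have -> : Num.max (2 * rho) (normc (w - c)) = 2 * rho.
  by apply/max_idPl; rewrite (le_trans h)// ler_peMl ?ler1n// ltW.
by rewrite lnM ?posrE// addrK divff// gt_eqF// ln2_gt0.
Qed.

Lemma tent_eq0 c rho w : 0 < rho -> 2 * rho <= normc (w - c) -> tent c rho w = 0.
Proof.
move=> r0 h; rewrite /tent /circle_potential.
have -> : Num.max (2 * rho) (normc (w - c)) = normc (w - c) by apply/max_idPr.
have -> : Num.max rho (normc (w - c)) = normc (w - c).
  by apply/max_idPr; rewrite (le_trans _ h)// ler_peMl ?ler1n// ltW.
by rewrite subrr mul0r.
Qed.

Lemma circle_potential_lipschitz c rho w w' : 0 < rho ->
  `|circle_potential c rho w - circle_potential c rho w'| <= rho^-1 * normc (w - w').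
Proof.
move=> r0.
have H u v : 0 <= v -> ln (Num.max rho u) - ln (Num.max rho v) <= rho^-1 * `|u - v|.
  move=> v0.
  have a0 : 0 < Num.max rho u by rewrite lt_max r0.
  have b0 : 0 < Num.max rho v by rewrite lt_max r0.
  have rb : rho <= Num.max rho v by rewrite le_max lexx.
  set a := Num.max rho u in a0 *; set b := Num.max rho v in b0 rb *.
  have ab : a - b <= `|u - v|.
    rewrite lerBlDr ge_max; apply/andP; split.
      by rewrite (le_trans rb)// lerDr.
    by rewrite -lerBlDr (le_trans _ (ler_norm _))// lerD2l lerN2 le_max lexx orbT.
  rewrite -ln_div ?posrE//.
  have q0 : 0 < a / b by rewrite divr_gt0.
  rewrite (@le_trans _ _ (a / b - 1))//.
    rewrite -{1}(subrK 1 (a / b)) addrC le_ln1Dx//.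
    by rewrite ltrBrDr addrC subrr.
  have -> : a / b - 1 = (a - b) / b by rewrite mulrBl divff// gt_eqF.
  rewrite ler_pdivrMr// (le_trans ab)// mulrC mulrA ler_peMl//.
  by rewrite ler_pdivlMr// mul1r.
have n1 := normc_ge0 (w - c); have n2 := normc_ge0 (w' - c).
have h : `|normc (w - c) - normc (w' - c)| <= normc (w - w').
  rewrite (le_trans (ler_dist_normc _ _))//.
  by have -> : w - c - (w' - c) = w - w' by ring.
have r0' : 0 <= rho^-1 by rewrite invr_ge0 ltW.
rewrite /circle_potential ler_norml lerNl opprB; apply/andP; split.
  by rewrite (le_trans (H _ _ n1))// distrC ler_wpM2l.
by rewrite (le_trans (H _ _ n2))// ler_wpM2l.
Qed.

Lemma continuous_tent c rho : 0 < rho -> continuous (tent c rho).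
Proof.
move=> r0; apply: (@lipschitz_continuous_normc _ _ (2 * rho^-1 / ln 2)) => w w'.
rewrite /tent -mulrBl normrM [X in _ * X <= _]ger0_norm ?invr_ge0 ?(ltW ln2_gt0)//.
rewrite mulrAC ler_wpM2r ?invr_ge0 ?(ltW ln2_gt0)//.
have h1 := circle_potential_lipschitz c w w' r0.
have r20 : 0 < 2 * rho by rewrite mulr_gt0.
have h2 := circle_potential_lipschitz c w w' r20.
have h3 : (2 * rho)^-1 * normc (w - w') <= rho^-1 * normc (w - w').
  rewrite ler_wpM2r ?normc_ge0// lef_pV2 ?posrE//.
  by rewrite ler_peMl ?ler1n// ltW.
move: h1 h2 h3; set A := circle_potential _ _ w; set B := circle_potential _ _ w.
set A' := circle_potential _ _ w'; set B' := circle_potential _ _ w'.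
have -> : B - A - (B' - A') = (B - B') - (A - A') by ring.
move=> h1 h2 h3; rewrite (le_trans (ler_normB _ _))// -[leRHS]mulrA mulr_natl mulr2n.
by rewrite lerD// (le_trans h2).
Qed.

Lemma measurable_tent c rho : 0 < rho -> measurable_fun setT (tent c rho).
Proof. by move=> r0; apply: continuous_measurable_complex; exact: continuous_tent. Qed.

(** A grid of mesh [1 / (M + 1)] that covers the square of half-side [M + 1]. *)
Definition grid_center (M p q : nat) : R[i] :=
  ((p%:R - M.+1%:R ^+ 2) / M.+1%:R) +i* ((q%:R - M.+1%:R ^+ 2) / M.+1%:R).

Definition grid_tent (t : nat * nat * nat) : R[i] -> R :=
  tent (grid_center t.1.1 t.1.2 t.2) t.1.1.+1%:R^-1.

Definition tent_comb (G : seq (R * (nat * nat * nat))) (w : R[i]) : R :=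
  \sum_(t <- G) t.1 * grid_tent t.2 w.

Lemma grid_tent_ge0 t w : 0 <= grid_tent t w.
Proof. by rewrite tent_ge0// invr_gt0. Qed.

Lemma grid_tent_le1 t w : grid_tent t w <= 1.
Proof. by rewrite tent_le1// invr_gt0. Qed.

Lemma continuous_lin2 (f g : R[i] -> R) (a b : R) : continuous f -> continuous g ->
  continuous (fun w => a * f w + b * g w).
Proof.
move=> /continuous_normcP cf /continuous_normcP cg; apply/continuous_normcP => x e e0.
have k0 : 0 < 2 * (`|a| + `|b| + 1).
  by rewrite mulr_gt0// ltr_wpDl// addr_ge0.
have e'0 : 0 < e / (2 * (`|a| + `|b| + 1)) by rewrite divr_gt0.
have [d1 d10 h1] := cf x _ e'0; have [d2 d20 h2] := cg x _ e'0.
exists (Num.min d1 d2); first by rewrite lt_min d10.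
move=> y; rewrite lt_min => /andP[/h1 {}h1 /h2 {}h2].
have -> : a * f x + b * g x - (a * f y + b * g y) =
  a * (f x - f y) + b * (g x - g y) by ring.
rewrite (le_lt_trans (ler_normD _ _))// !normrM.
set s := e / _ in e'0 h1 h2.
apply: (@le_lt_trans _ _ (`|a| * s + `|b| * s)).
  by rewrite lerD// ler_wpM2l// ltW.
have -> : e = s * (2 * (`|a| + `|b| + 1)) by rewrite divfK// gt_eqF.
have a0 := normr_ge0 a; have b0 := normr_ge0 b; nra.
Qed.

Lemma continuous_tent_comb G : continuous (tent_comb G).
Proof.
elim: G => [|t G ih].
  rewrite (_ : tent_comb [::] = (fun=> 0)); first exact: cst_continuous.
  by apply/funext => w; rewrite /tent_comb big_nil.
rewrite (_ : tent_comb _ = (fun w => t.1 * grid_tent t.2 w + 1 * tent_comb G w)); last first.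
  by apply/funext => w; rewrite /tent_comb big_cons mul1r.
have ct : continuous (grid_tent t.2) by apply: continuous_tent; rewrite invr_gt0.
exact: continuous_lin2.
Qed.

(** An open interval of length 4 contains at most four integers. *)
Lemma count_close (N : nat) (u : R) :
  \sum_(p < N) (`|u - p%:R| < 2)%R%:R <= 4 :> R.
Proof.
pose t := Num.truncn u.
apply: (@le_trans _ _ (\sum_(p < N) (((p : nat) == t.-1)%:R + ((p : nat) == t)%:R +
    ((p : nat) == t.+1)%:R + ((p : nat) == t.+2)%:R))).
  apply: ler_sum => p _.
  case: (ltP `|u - p%:R| 2) => [|_]; last by rewrite !addr_ge0.
  rewrite ltr_norml => /andP[h1 h2].
  have pt : (p <= t.+2)%N.
    have u1 := truncnS_gt u; rewrite -/t -natr1 in u1.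
    by rewrite -ltnS -(ltr_nat R) -!natr1; lra.
  have tp : (t <= p.+1)%N.
    have [u0|u0] := leP 0 u.
      have /andP[t1 t2] := truncn_itv u0; rewrite -/t in t1 t2.
      by rewrite -ltnS -(ltr_nat R) -!natr1; lra.
    suff -> : t = 0%N by [].
    by apply/truncn0Pn; rewrite -ltNge (lt_trans u0).
  have hor : [|| (p : nat) == t.-1, (p : nat) == t, (p : nat) == t.+1 | (p : nat) == t.+2].
    by move: pt tp; case: t => [|t] /=; lia.
  have b0 (b : bool) : 0 <= b%:R :> R by [].
  have b1 := b0 ((p : nat) == t.-1); have b2 := b0 ((p : nat) == t).
  have b3 := b0 ((p : nat) == t.+1); have b4 := b0 ((p : nat) == t.+2).
  by case/or4P: hor => ->; rewrite mulr1n; lra.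
rewrite !big_split/=.
have S1 (s : nat) : \sum_(i < N) (i == s :> nat)%:R <= 1 :> R by exact: sum_eq_le1.
have := S1 t.-1; have := S1 t; have := S1 t.+1; have := S1 t.+2.
move=> s1 s2 s3 s4; rewrite (_ : 4 = 1 + 1 + 1 + 1 :> R); last by ring.
by rewrite !lerD.
Qed.

Definition grid_size (M : nat) := (2 * M.+1 ^ 2).+1.

Definition ball_inf (f : R[i] -> R) (M p q : nat) : R :=
  inf [set f w | w in [set w | normc (w - grid_center M p q) < 2 / M.+1%:R]].

(** At most 16 of the tents of the grid are nonzero at a given point, which is why
    the factor [1 / 16] keeps the combination below [f]. *)
Definition grid_comb (f : R[i] -> R) (M : nat) : seq (R * (nat * nat * nat)) :=
  [seq (16^-1 * ball_inf f M (nat_of_ord pq.1) (nat_of_ord pq.2),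
        ((M, nat_of_ord pq.1), nat_of_ord pq.2)) |
    pq <- enum {: 'I_(grid_size M) * 'I_(grid_size M)}].

Lemma tent_comb_gridE f M w : tent_comb (grid_comb f M) w =
  \sum_(p < grid_size M) \sum_(q < grid_size M) 16^-1 * ball_inf f M p q * grid_tent ((M, p : nat), q : nat) w.
Proof.
rewrite pair_bigA/= /tent_comb /grid_comb big_map big_enum/=.
by apply: eq_bigr => -[p q] _.
Qed.

Section nonneg.
Variable f : R[i] -> R.
Hypothesis f0 : forall w, 0 <= f w.

Lemma ball_inf_le M p q w : normc (w - grid_center M p q) < 2 / M.+1%:R ->
  ball_inf f M p q <= f w.
Proof.
move=> h; apply: ge_inf; last by exists w.
by exists 0 => _ [x _ <-].
Qed.

Lemma ball_inf_ge M p q (a : R) :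
  (forall w, normc (w - grid_center M p q) < 2 / M.+1%:R -> a <= f w) ->
  a <= ball_inf f M p q.
Proof.
move=> h; apply: lb_le_inf; last by move=> _ [x hx <-]; exact: h.
have h0 : normc (grid_center M p q - grid_center M p q) < 2 / M.+1%:R.
  have /eqP -> : normc (grid_center M p q - grid_center M p q) == 0.
    by rewrite normc_eq0 subrr.
  by rewrite divr_gt0.
by exists (f (grid_center M p q)), (grid_center M p q).
Qed.

Lemma ball_inf_ge0 M p q : 0 <= ball_inf f M p q.
Proof. exact: ball_inf_ge. Qed.

Lemma grid_comb_ge0 M t : t \in grid_comb f M -> 0 <= t.1.
Proof. by move=> /mapP[pq _ ->] /=; rewrite mulr_ge0// ball_inf_ge0. Qed.

Lemma grid_comb_le M w : tent_comb (grid_comb f M) w <= f w.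
Proof.
rewrite tent_comb_gridE.
set m := M.+1%:R : R.
have m0 : 0 < m by rewrite /m ltr0n.
pose u := Re w * m + m ^+ 2; pose v := Im w * m + m ^+ 2.
apply: (@le_trans _ _ (\sum_(p < grid_size M) \sum_(q < grid_size M)
    16^-1 * f w * ((`|u - p%:R| < 2)%R%:R * (`|v - q%:R| < 2)%R%:R))).
  apply: ler_sum => p _; apply: ler_sum => q _.
  have [far|near] := leP (2 * m^-1) (normc (w - grid_center M p q)).
    by rewrite /grid_tent tent_eq0 ?invr_gt0//= mulr0 mulr_ge0 ?mulr_ge0.
  have Reb : `|u - p%:R| < 2.
    have := le_lt_trans (ler_Re _) near.
    rewrite ReD ReN /grid_center/= -/m.
    rewrite -(ltr_pM2r m0) -[X in `|_| * X](gtr0_norm m0) -normrM.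
    rewrite divfK ?gt_eqF// mulrBl divfK ?gt_eqF//.
    by congr (`|_| < _); rewrite /u; ring.
  have Imb : `|v - q%:R| < 2.
    have := le_lt_trans (ler_Im _) near.
    rewrite ImD ImN /grid_center/= -/m.
    rewrite -(ltr_pM2r m0) -[X in `|_| * X](gtr0_norm m0) -normrM.
    rewrite divfK ?gt_eqF// mulrBl divfK ?gt_eqF//.
    by congr (`|_| < _); rewrite /v; ring.
  rewrite Reb Imb mulr1 mulr1 -!mulrA ler_wpM2l// -[leRHS]mulr1.
  by rewrite ler_pM ?ball_inf_ge0 ?grid_tent_ge0 ?grid_tent_le1// ball_inf_le.
under eq_bigr do rewrite -mulr_sumr -mulr_sumr.
rewrite -mulr_sumr -mulr_suml.
have s1 := count_close (grid_size M) u; have s2 := count_close (grid_size M) v.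
have s0 (z : R) : 0 <= \sum_(p < grid_size M) (`|z - p%:R| < 2)%R%:R :> R by rewrite sumr_ge0.
have h : (\sum_(p < grid_size M) (`|u - p%:R| < 2)%R%:R) * (\sum_(p < grid_size M) (`|v - p%:R| < 2)%R%:R) <= 4 * 4 :> R.
  by rewrite ler_pM.
rewrite (le_trans (ler_wpM2l _ h))//; first by rewrite mulr_ge0.
by rewrite le_eqVlt; apply/orP; left; apply/eqP; field.
Qed.

Hypothesis cf : continuous f.

(** Some centre is within [1 / (M + 1)] of [w], so that its tent is 1 there, and by
    continuity [f] varies little on the support of this tent. *)
Lemma grid_comb_ge w (e : R) : 0 < e ->
  exists M0, forall M, (M0 <= M)%N -> 16^-1 * (f w - e) <= tent_comb (grid_comb f M) w.
Proof.
move=> e0; have [dl dl0 hdl] := (continuous_normcP f).1 cf w e e0.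
exists (Num.truncn (normc w + 3 / dl)) => M M0M.
set m := M.+1%:R : R.
have m0 : 0 < m by rewrite /m ltr0n.
have mw : normc w + 3 / dl < m.
  by rewrite (lt_le_trans (truncnS_gt _))// /m ler_nat ltnS.
have dl3 : 0 < 3 / dl by rewrite divr_gt0.
have nw := normc_ge0 w.
have m1 : 1 <= m by rewrite /m (ler_nat R 1).
have H a : `|a| <= normc w -> exists2 p : 'I_(grid_size M), True & `|a * m + m ^+ 2 - p%:R| <= 2^-1.
  (* Rounding to the nearest grid point: both coordinates are then within half a mesh. *)
  move=> aw; pose y := a * m + m ^+ 2 + 2^-1.
  have am : `|a| < m by lra.
  have [a1 a2] : - m < a /\ a < m by apply/andP; rewrite -ltr_norml.
  have y0 : 0 <= y by rewrite /y; nra.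
  have /andP[t1 t2] := truncn_itv y0.
  have pN : (Num.truncn y < grid_size M)%N.
    rewrite -(ltr_nat R) (le_lt_trans t1)// /grid_size -natr1 natrM natrX -/m /y; nra.
  exists (Ordinal pN) => //=; rewrite ler_norml; move: t1 t2; rewrite -natr1 /y.
  by move=> t1 t2; apply/andP; split; lra.
have [p _ hp] := H _ (ler_Re w); have [q _ hq] := H _ (ler_Im w).
have wpq : normc (w - grid_center M p q) <= m^-1.
  rewrite (le_trans (normc_ReIm _))// ReD ReN ImD ImN /grid_center/= -/m.
  have E a (s : nat) : `|a - (s%:R - m ^+ 2) / m| = `|a * m + m ^+ 2 - s%:R| / m.
    rewrite -[X in _ = _ / X](gtr0_norm m0) -normf_div; congr `|_|.
    by field; rewrite gt_eqF.
  rewrite !E -mulrDl -[leRHS]mul1r ler_wpM2r ?invr_ge0 ?(ltW m0)//.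
  by rewrite (le_trans (lerD hp hq))//; lra.
have inf_ge : f w - e <= ball_inf f M p q.
  apply: ball_inf_ge => w' hw'.
  have : `|f w - f w'| < e.
    apply: hdl.
    have -> : w - w' = (w - grid_center M p q) - (w' - grid_center M p q) by ring.
    rewrite (le_lt_trans (ler_normcD _ _))// normcN1.
    apply: (@lt_trans _ _ (3 / m)).
      by rewrite (_ : 3 / m = m^-1 + 2 / m); [rewrite ler_ltD|field; rewrite gt_eqF].
    by rewrite ltr_pdivrMr// mulrC -ltr_pdivrMr//; lra.
  by rewrite ltr_norml => /andP[h1 h2]; lra.
have term0 p' q' : 0 <= 16^-1 * ball_inf f M p' q' * grid_tent ((M, p'), q') w.
  by rewrite mulr_ge0 ?grid_tent_ge0// mulr_ge0// ball_inf_ge0.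
rewrite tent_comb_gridE (bigD1 p)//= (bigD1 q)//=.
rewrite /grid_tent tent_eq1 ?invr_gt0//= mulr1 -addrA.
apply: ler_wpDr; last by rewrite ler_wpM2l.
by rewrite addr_ge0// sumr_ge0// => *; rewrite ?sumr_ge0.
Qed.

End nonneg.
End tents.

Section cone_approximation.
Context {R : realType}.
Variable mu : probability R[i] R.
Implicit Types (f : R[i] -> R) (G : seq (R * (nat * nat * nat))).

Definition nonneg_comb G := forall t, t \in G -> 0 <= t.1.

Lemma tent_comb_ge0 G w : nonneg_comb G -> 0 <= tent_comb G w.
Proof.
move=> G0; rewrite /tent_comb big_seq sumr_ge0// => t tG.
by rewrite mulr_ge0 ?grid_tent_ge0// G0.
Qed.

Lemma continuous_bounded_integrable f (a b : R) : continuous f ->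
  (forall w, a <= f w <= b) -> mu.-integrable setT (EFin \o f).
Proof.
by move=> cf; apply: bounded_integrable; exact: continuous_measurable_complex.
Qed.

(** The truncations [min (grid_comb, f / 16)] converge pointwise to [f / 16], so by
    dominated convergence their integrals are eventually at least half of that of
    [f / 16]. *)
Lemma cone_step f (B : R) : continuous f -> (forall w, 0 <= f w <= B) ->
  exists G, [/\ nonneg_comb G, forall w, tent_comb G w <= f w &
    (\int[mu]_w f w) / 32 <= \int[mu]_w tent_comb G w].
Proof.
move=> cf fB.
have f0 w : 0 <= f w by have /andP[] := fB w.
have fi := continuous_bounded_integrable cf fB.
have If0 : 0 <= \int[mu]_w f w by apply: Rintegral_ge0.
have [If|If] := leP (\int[mu]_w f w) 0.
  exists [::]; split => //.
    by move=> w; rewrite /tent_comb big_nil.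
  apply: (@le_trans _ _ 0); first by rewrite pmulr_lle0// invr_gt0.
  by apply: Rintegral_ge0 => w _; rewrite /tent_comb big_nil.
pose g M := tent_comb (grid_comb f M).
have gM0 M : nonneg_comb (grid_comb f M) by move=> t; exact: grid_comb_ge0.
have g0 M w : 0 <= g M w by exact: tent_comb_ge0.
have gf M w : g M w <= f w by exact: grid_comb_le.
have mg M : measurable_fun setT (g M).
  by apply: continuous_measurable_complex; exact: continuous_tent_comb.
have mf : measurable_fun setT f by exact: continuous_measurable_complex.
pose h M w := Num.min (g M w) (16^-1 * f w).
have mh M : measurable_fun setT (h M).
  by apply: measurable_minr => //; exact: measurable_funM.
have h0 M w : 0 <= h M w by rewrite le_min g0 mulr_ge0.
have hf M w : h M w <= f w by rewrite ge_min gf.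
have hcvg w : h ^~ w @ \oo --> 16^-1 * f w.
  apply/cvgrPdist_le => e e0.
  have [M0 hM0] := grid_comb_ge f0 cf w e0.
  near=> M.
  have M0M : (M0 <= M)%N by near: M; exists M0.
  have lo : 16^-1 * (f w - e) <= h M w.
    by rewrite le_min hM0//= ler_wpM2l// gerBl ltW.
  have up : h M w <= 16^-1 * f w by rewrite ge_min lexx orbT.
  rewrite ger0_norm ?subr_ge0// lerBlDr -lerBlDl (le_trans _ lo)// mulrBr.
  by rewrite lerD2l lerN2 ler_piMl ?(ltW e0)// invf_le1// ler1n.
have [] := @dominated_convergence _ _ _ mu setT measurableT
  (fun M w => (h M w)%:E) (fun w => (16^-1 * f w)%:E) (EFin \o f).
- by move=> M; exact/measurable_EFinP.
- by apply/measurable_EFinP; exact: measurable_funM.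
- by apply: aeW => w _; apply: cvg_EFin; [exact: nearW|exact: hcvg].
- exact: fi.
- by apply: aeW => w M _; rewrite /= lee_fin ger0_norm.
move=> _ _ icvg.
have I16 : (\int[mu]_w (16^-1 * f w)%:E)%E = (16^-1 * \int[mu]_w f w)%:E.
  rewrite -RintegralZl// /Rintegral fineK//.
  apply: integrable_fin_num => //.
  apply: (continuous_bounded_integrable (a := 0) (b := 16^-1 * B)).
    rewrite (_ : (fun w => _) = (fun w => 16^-1 * f w + 0 * f w)).
      exact: continuous_lin2.
    by apply/funext => w; rewrite mul0r addr0.
  by move=> w; rewrite mulr_ge0//= ler_wpM2l//; have /andP[] := fB w.
rewrite I16 in icvg.
have /fine_cvgP[_ rcvg] := icvg.
have e0 : 0 < (\int[mu]_w f w) / 32 by rewrite divr_gt0.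
move/cvgrPdist_le : rcvg => /(_ _ e0)[M _ /(_ M (leqnn M))] hM.
exists (grid_comb f M); split; [exact: gM0|exact: gf|].
have hle : \int[mu]_w h M w <= \int[mu]_w g M w.
  apply: (le_Rintegral_prob mu (a := 0) (b := B) (a' := 0) (b' := B)) => // w.
  - by rewrite h0 (le_trans (hf M w))//; have /andP[] := fB w.
  - by rewrite g0 (le_trans (gf M w))//; have /andP[] := fB w.
  - by rewrite ge_min lexx.
apply: (le_trans _ hle).
move: hM; rewrite /= -/(Rintegral mu setT (h M)) ler_norml => /andP[_].
set I := \int[mu]_w f w; set J := \int[mu]_w h M w => hM.
by lra.
Unshelve. all: by end_near. Qed.

Lemma tent_comb_cat G G' w : tent_comb (G ++ G') w = tent_comb G w + tent_comb G' w.
Proof. by rewrite /tent_comb big_cat. Qed.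

(** The remainder [f - g] is again continuous, nonnegative and bounded, and each step
    removes at least 1/32 of its integral. *)
Lemma cone_iterate f (B : R) (k : nat) : continuous f -> (forall w, 0 <= f w <= B) ->
  exists G, [/\ nonneg_comb G, forall w, tent_comb G w <= f w &
    \int[mu]_w f w - \int[mu]_w tent_comb G w <= (31 / 32) ^+ k * \int[mu]_w f w].
Proof.
move=> cf fB; have f0 w : 0 <= f w by have /andP[] := fB w.
have fi := continuous_bounded_integrable cf fB.
elim: k => [|k [G [G0 Gf GI]]].
  exists [::]; split => //.
    by move=> w; rewrite /tent_comb big_nil.
  rewrite expr0 mul1r gerBl; apply: Rintegral_ge0 => w _.
  by rewrite /tent_comb big_nil.
have GB w : 0 <= tent_comb G w <= B.
  by rewrite tent_comb_ge0//= (le_trans (Gf w))//; have /andP[] := fB w.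
have Gi := continuous_bounded_integrable (@continuous_tent_comb R G) GB.
pose r w := f w - tent_comb G w.
have rE : r = (fun w => 1 * f w + (-1) * tent_comb G w).
  by apply/funext => w; rewrite /r mul1r mulN1r.
have cr : continuous r.
  by rewrite rE; apply: continuous_lin2 => //; exact: continuous_tent_comb.
have rB w : 0 <= r w <= B.
  rewrite /r subr_ge0 Gf/= lerBlDr (le_trans (_ : _ <= B))//.
    by have /andP[] := fB w.
  by rewrite lerDl; have /andP[] := GB w.
have [G' [G'0 G'r G'I]] := cone_step cr rB.
have G'B w : 0 <= tent_comb G' w <= B.
  by rewrite tent_comb_ge0//= (le_trans (G'r w))//; have /andP[] := rB w.
have G'i := continuous_bounded_integrable (@continuous_tent_comb R G') G'B.
have rI : \int[mu]_w r w = \int[mu]_w f w - \int[mu]_w tent_comb G w.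
  exact: RintegralB.
exists (G ++ G'); split.
- by move=> t; rewrite mem_cat => /orP[/G0|/G'0].
- by move=> w; rewrite tent_comb_cat -lerBrDl; exact: G'r.
have -> : \int[mu]_w tent_comb (G ++ G') w =
    \int[mu]_w tent_comb G w + \int[mu]_w tent_comb G' w.
  rewrite -RintegralD//; apply: eq_Rintegral => w _; exact: tent_comb_cat.
rewrite exprS; move: G'I; rewrite rI.
set I := \int[mu]_w f w in GI *; set J := \int[mu]_w tent_comb G w in GI *.
set J' := \int[mu]_w tent_comb G' w; set x := (31 / 32) ^+ k in GI *.
by rewrite -mulrA; move: GI; move: (x * I) => y; lra.
Qed.

Lemma cone_approx f (B e : R) : continuous f -> (forall w, 0 <= f w <= B) -> 0 < e ->
  exists G, [/\ nonneg_comb G, forall w, tent_comb G w <= f w &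
    \int[mu]_w f w - e <= \int[mu]_w tent_comb G w].
Proof.
move=> cf fB e0.
have f0 w : 0 <= f w by have /andP[] := fB w.
have If0 : 0 <= \int[mu]_w f w by apply: Rintegral_ge0.
have q1 : `|31 / 32 : R| < 1 by rewrite ger0_norm ?divr_ge0// ltr_pdivrMr// mul1r ltr_nat.
have e'0 : 0 < e / (\int[mu]_w f w + 1) by rewrite divr_gt0// ltr_wpDl.
have /cvgr0Pnorm_lt /(_ _ e'0) [k _ /(_ k (leqnn k))] := cvg_expr q1.
rewrite /= ger0_norm ?exprn_ge0// ?divr_ge0// => hk.
have [G [G0 Gf GI]] := cone_iterate k cf fB.
exists G; split => //.
have : (31 / 32) ^+ k * \int[mu]_w f w <= e.
  apply: (@le_trans _ _ (e / (\int[mu]_w f w + 1) * \int[mu]_w f w)).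
    by rewrite ler_wpM2r// ltW.
  rewrite mulrAC ler_pdivrMr ?ltr_wpDl// ler_wpM2l ?(ltW e0)// lerDl//.
by lra.
Qed.

End cone_approximation.

(** * Weak convergence *)

Section empirical_integrals.
Context {R : realType}.

Lemma integral_empirical (n : nat) (z : n.-tuple R[i]) (f : R[i] -> R) :
  measurable_fun setT f ->
  (\int[empirical_measure z]_x (f x)%:E = (n%:R^-1 * \sum_(k < n) f (tnth z k))%:E)%E.
Proof.
move=> mf.
have H (g : R[i] -> R) : measurable_fun setT g -> (forall x, 0 <= g x) ->
    (\int[empirical_measure z]_x (g x)%:E = (n%:R^-1 * \sum_(k < n) g (tnth z k))%:E)%E.
  move=> mg g0; rewrite /empirical_measure ge0_integral_mscale//; last 2 first.
  - exact/measurable_EFinP.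
  - by move=> x _; rewrite lee_fin.
  rewrite ge0_integral_measure_sum//; last 2 first.
  - by move=> x _; rewrite lee_fin.
  - exact/measurable_EFinP.
  rewrite EFinM -sumEFin; congr (_ * _)%E; apply: eq_bigr => k _.
  rewrite integral_dirac//; last exact/measurable_EFinP.
  by rewrite diracT mul1e (tnth_nth 0).
rewrite integralE.
have -> : (fun x => (f x)%:E)^\+%E = (fun x => (Num.max (f x) 0)%:E).
  by apply/funext => x; rewrite funeposE EFin_max.
have -> : (fun x => (f x)%:E)^\-%E = (fun x => (Num.max (- f x) 0)%:E).
  by apply/funext => x; rewrite funenegE EFin_max.
have mp : measurable_fun setT (fun x => Num.max (f x) 0) by exact: measurable_maxr.
have mm : measurable_fun setT (fun x => Num.max (- f x) 0).
  by apply: measurable_maxr => //; exact: measurable_funN.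
rewrite (H _ mp); last by move=> x; rewrite le_max lexx orbT.
rewrite (H _ mm); last by move=> x; rewrite le_max lexx orbT.
rewrite -EFinB -mulrBr -sumrB; congr ((_ * _)%:E); apply: eq_bigr => k _.
by case: (leP 0 (f (tnth z k))) => h; case: (leP 0 (- f (tnth z k))) => h'; lra.
Qed.

End empirical_integrals.

Section weak_convergence.
Context {R : realType}.
Variables (mu : probability R[i] R) (z : forall n : nat, 'I_n -> R[i]).
Arguments z : clear implicits.

Let avg n (f : R[i] -> R) := n%:R^-1 * \sum_(k < n) f (z n k).

Hypothesis tent_lower : forall (t : nat * nat * nat) (e : R), 0 < e ->
  exists n1, forall n, (n1 <= n)%N -> \int[mu]_w grid_tent t w - e <= avg n (grid_tent t).

Lemma measurable_grid_tent t : measurable_fun setT (@grid_tent R t).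
Proof. by apply: measurable_tent; rewrite invr_gt0. Qed.

Lemma tent_comb_lower G (e : R) : nonneg_comb G -> 0 < e ->
  exists n1, forall n, (n1 <= n)%N ->
    \int[mu]_w tent_comb G w - e <= avg n (tent_comb G).
Proof.
elim: G e => [|t G ih] e G0 e0.
  exists 0%N => n _.
  have -> : \int[mu]_w tent_comb [::] w = 0.
    rewrite -[RHS](Rintegral_cst_prob mu); apply: eq_Rintegral => w _.
    by rewrite /tent_comb big_nil.
  rewrite /avg big1 => [|k _]; last by rewrite /tent_comb big_nil.
  by rewrite mulr0 sub0r oppr_le0 ltW.
have t0 : 0 <= t.1 by apply: G0; rewrite mem_head.
have G0' : nonneg_comb G by move=> s sG; apply: G0; rewrite inE sG orbT.
have e2 : 0 < e / 2 by rewrite divr_gt0.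
have e3 : 0 < e / 2 / (t.1 + 1) by rewrite divr_gt0// ltr_wpDl.
have [n1 h1] := ih _ G0' e2.
have [n2 h2] := tent_lower t.2 e3.
exists (maxn n1 n2) => n; rewrite geq_max => /andP[/h1 {}h1 /h2 {}h2].
have consE w : tent_comb (t :: G) w = t.1 * grid_tent t.2 w + tent_comb G w.
  by rewrite /tent_comb big_cons.
have ti : mu.-integrable setT (EFin \o grid_tent t.2).
  apply: (bounded_integrable mu (a := 0) (b := 1)); first exact: measurable_grid_tent.
  by move=> w; rewrite grid_tent_ge0 grid_tent_le1.
have Gi : mu.-integrable setT (EFin \o tent_comb G).
  apply: (bounded_integrable mu (a := 0) (b := \sum_(s <- G) s.1)).
    by apply: continuous_measurable_complex; exact: continuous_tent_comb.
  move=> w; rewrite tent_comb_ge0//= /tent_comb big_seq [leRHS]big_seq.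
  by apply: ler_sum => s sG; rewrite ler_piMr ?grid_tent_le1// G0'.
have tti : mu.-integrable setT (EFin \o (fun w => t.1 * grid_tent t.2 w)).
  apply: (bounded_integrable mu (a := 0) (b := t.1)).
    by apply: measurable_funM => //; exact: measurable_grid_tent.
  by move=> w; rewrite mulr_ge0 ?grid_tent_ge0//= ler_piMr ?grid_tent_le1.
have -> : \int[mu]_w tent_comb (t :: G) w =
    t.1 * \int[mu]_w grid_tent t.2 w + \int[mu]_w tent_comb G w.
  rewrite -RintegralZl// -RintegralD//; apply: eq_Rintegral => w _; exact: consE.
have -> : avg n (tent_comb (t :: G)) = t.1 * avg n (grid_tent t.2) + avg n (tent_comb G).
  rewrite /avg [t.1 * _]mulrCA -mulrDr [t.1 * _]mulr_sumr -big_split/=; congr (_ * _).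
  by apply: eq_bigr => k _; exact: consE.
have h3 : t.1 * (e / 2 / (t.1 + 1)) <= e / 2.
  rewrite mulrCA ler_piMr ?(ltW e2)// ler_pdivrMr ?ltr_wpDl// mul1r.
  by rewrite lerDl.
have h4 := ler_wpM2l t0 h2; rewrite mulrBr in h4.
by lra.
Qed.

Lemma average_lower (f : R[i] -> R) (B e : R) : continuous f -> (forall w, 0 <= f w <= B) -> 0 < e ->
  exists n1, forall n, (n1 <= n)%N -> \int[mu]_w f w - e <= avg n f.
Proof.
move=> cf fB e0; have e2 : 0 < e / 2 by rewrite divr_gt0.
have [G [G0 Gf GI]] := cone_approx mu cf fB e2.
have [n1 h1] := tent_comb_lower G0 e2.
exists n1 => n /h1 {}h1.
have : avg n (tent_comb G) <= avg n f.
  by rewrite /avg ler_wpM2l ?invr_ge0// ler_sum.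
by lra.
Qed.

(** Lower bounds for the averages of [M + f] and of [M - f], both nonnegative, are
    lower and upper bounds for those of [f]. *)
Lemma weak_cvg_of_tents : weak_cvg (fun n => empirical_measure [tuple z n k | k < n]) mu.
Proof.
move=> f cf [M0 [_ fM0]].
pose M := `|M0| + 1.
have M0M : M0 < M by rewrite (le_lt_trans (ler_norm _))// ltrDl.
have fM w : `|f w| <= M by apply: (fM0 M M0M).
have fMM w : - M <= f w <= M by rewrite -ler_norml.
have mf : measurable_fun setT f by exact: continuous_measurable_complex.
have fi := continuous_bounded_integrable mu cf fMM.
have If : (\int[mu]_w (f w)%:E)%E = (\int[mu]_w f w)%:E.
  by rewrite /Rintegral fineK//; exact: integrable_fin_num.
rewrite If.
have -> : (fun n => \int[empirical_measure [tuple z n k | k < n]]_w (f w)%:E)%E =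
    (fun n => (avg n f)%:E).
  apply/funext => n; rewrite integral_empirical//; congr (_ * _)%:E.
  by apply: eq_bigr => k _; rewrite tnth_mktuple.
apply: cvg_EFin; first exact: nearW.
have two_sided (a : R) : `|a| = 1 -> forall e, 0 < e -> exists n1, forall n, (n1 <= n)%N ->
    a * \int[mu]_w f w - e <= a * avg n f.
  move=> a1 e e0.
  pose g w := a * f w + 1 * M.
  have cg : continuous g by apply: continuous_lin2 => //; exact: cst_continuous.
  have gB w : 0 <= g w <= M + M.
    have : `|a * f w| <= M by rewrite normrM a1 mul1r.
    by rewrite ler_norml /g mul1r => /andP[h1 h2]; apply/andP; split; lra.
  have [n1 h1] := average_lower cg gB e0.
  exists (maxn 1 n1) => n; rewrite geq_max => /andP[n0 /h1].
  have n0R : n%:R != 0 :> R by rewrite pnatr_eq0 -lt0n.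
  have -> : avg n g = a * avg n f + M.
    rewrite /avg big_split/= sumr_const card_ord mul1r mulrDr -mulr_sumr mulrCA.
    by rewrite -[M *+ n]mulr_natl mulKf.
  have -> : \int[mu]_w g w = a * \int[mu]_w f w + M.
    rewrite -RintegralZl// -[X in _ + X](Rintegral_cst_prob mu) -RintegralD//; last 2 first.
    - apply: (bounded_integrable mu (a := - M) (b := M)); first exact: measurable_funM.
      by move=> w; rewrite -ler_norml normrM a1 mul1r.
    - by apply: (bounded_integrable mu (a := M) (b := M)) => // w; rewrite lexx.
    by apply: eq_Rintegral => w _; rewrite /g mul1r.
  by lra.
apply/cvgrPdist_le => e e0.
have [n1 h1] := two_sided 1 (normr1 _) e e0.
have [n2 h2] := two_sided (-1) (normrN1 _) e e0.
exists (maxn n1 n2) => // n /=; rewrite geq_max => /andP[/h1 {}h1 /h2 {}h2].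
by rewrite ler_norml; apply/andP; split; lra.
Qed.

End weak_convergence.

Unset Implicit Arguments.

Theorem theorem6 (R : realType) (d : measure_display)
    (Omega : measurableType d) (P : probability Omega R)
    (beta : R) (mu : probability R[i] R) (m : nat -> nat)
    (gam : forall n : nat, nat -> 'I_n -> {RV P >-> R})
    (Z : forall n : nat, nat -> 'I_n -> {RV P >-> R[i]}) :
  0 < beta ->
  polynomial_tail mu ->
  (forall n, (2 <= n)%N -> (1 <= m n <= n.-1)%N) ->
  (forall n, (2 <= n)%N -> iid P (Z n 0%N) mu) ->
  (forall n, (2 <= n)%N ->
     iterated_circular_derivatives P (m n) beta (gam n) (Z n)) ->
  (m n)%:R / (n%:R / ln n%:R) @[n --> \oo] --> (0 : R) ->
  {ae P, forall w,
    weak_cvg (fun n => empirical_measure [tuple Z n (m n) k w | k < n]) mu}.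
Proof.
move=> beta0 _ mn iidZ iterZ mlim.
have close (t : nat * nat * nat) : {ae P, forall w,
    (n%:R^-1 * (\sum_(k < n) grid_tent t (Z n (m n) k w) -
      \sum_(k < n) grid_tent t (Z n 0%N k w))) @[n --> \oo] --> (0 : R)}.
  pose c : R[i] := grid_center t.1.1 t.1.2 t.2; pose rho : R := t.1.1.+1%:R^-1.
  have rho0 : 0 < rho by rewrite invr_gt0.
  have rho20 : 0 < 2 * rho by rewrite mulr_gt0.
  apply: filterS2 (potentials_close_ae beta0 mn iterZ c rho0 mlim)
    (potentials_close_ae beta0 mn iterZ c rho20 mlim) => w h1 h2.
  have lin (u v : nat -> R) : u n @[n --> \oo] --> (0 : R) -> v n @[n --> \oo] --> (0 : R) ->
      (ln 2)^-1 * (v n - u n) @[n --> \oo] --> (0 : R).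
    move=> hu hv; have e0 : 0 = (ln 2)^-1 * (0 - 0) :> R by rewrite subrr mulr0.
    by rewrite [X in _ --> X]e0; apply: cvgMr; apply: cvgB.
  apply: cvg_trans (lin _ _ h1 h2); apply: near_eq_cvg; apply: nearW => n /=.
  rewrite -mulrBr mulrCA; congr (_ * _).
  have E j : \sum_(k < n) grid_tent t (Z n j k w) =
      (ln 2)^-1 * (\sum_(k < n) circle_potential c (2 * rho) (Z n j k w) -
        \sum_(k < n) circle_potential c rho (Z n j k w)).
    rewrite -sumrB mulr_sumr; apply: eq_bigr => k _.
    by rewrite /grid_tent /tent mulrC.
  by rewrite !E -mulrBr; congr (_ * _); ring.
have start (t : nat * nat * nat) (j : nat) : {ae P, forall w, exists n1, forall n, (n1 <= n)%N ->
    \int[mu]_x grid_tent t x - j.+1%:R^-1 <= n%:R^-1 * \sum_(k < n) grid_tent t (Z n 0%N k w)}.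
  apply: (average_lower_ae (Z := fun n => Z n 0%N) iidZ).
  - exact: measurable_grid_tent.
  - by move=> x; rewrite grid_tent_ge0 grid_tent_le1.
  - by rewrite invr_gt0.
have : {ae P, forall w, forall a b c j,
    (n%:R^-1 * (\sum_(k < n) grid_tent ((a, b), c) (Z n (m n) k w) -
      \sum_(k < n) grid_tent ((a, b), c) (Z n 0%N k w))) @[n --> \oo] --> (0 : R) /\
    exists n1, forall n, (n1 <= n)%N ->
    \int[mu]_x grid_tent ((a, b), c) x - j.+1%:R^-1 <=
      n%:R^-1 * \sum_(k < n) grid_tent ((a, b), c) (Z n 0%N k w)}.
  apply: ae_foralln => a; apply: ae_foralln => b; apply: ae_foralln => c.
  apply: ae_foralln => j.
  by apply: filterS2 (close (a, b, c)) (start (a, b, c) j).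
apply: filterS => w hw.
apply: (@weak_cvg_of_tents R mu (fun n k => Z n (m n) k w)) => -[[a b] c] e e0.
pose j := Num.truncn (2 / e).
have ej : j.+1%:R^-1 < e / 2.
  rewrite -[e / 2]invrK ltf_pV2 ?posrE ?invr_gt0 ?divr_gt0// invf_div.
  exact: truncnS_gt.
have [hlim [n1 hn1]] := hw a b c j.
have e2 : 0 < e / 2 by rewrite divr_gt0.
move/cvgr0Pnorm_le : hlim => /(_ _ e2)[n2 _ hn2].
exists (maxn n1 n2) => n; rewrite geq_max => /andP[/hn1 {}hn1 /hn2 {}hn2].
move: hn2; rewrite /= mulrBr ler_norml => /andP[hn2 _].
have arith (x y y' u : R) : x - u <= y -> - (e / 2) <= y' - y -> u < e / 2 -> x - e <= y'.
  by move=> *; lra.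
exact: arith hn1 hn2 ej.
Qed.
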